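(* Let $f\in C(\Omega\cup\Gamma_N)$ be bounded and $g\in C(\Gamma_D)$. Then there exist $\underline u,\overline u\in C(\bar\Omega)$, each a viscosity solution of $$-\Delta_\infty u-\beta|Du|=f\text{ in }\Omega,\qquad D_\nu u=0\text{ on }\Gamma_N,\qquad u=g\text{ on }\Gamma_D,$$ such that: if $u\in USC(\bar\Omega)$ is a viscosity subsolution of the system ($-\Delta_\infty u-\beta|Du|\le f$ in $\Omega$, $D_\nu u\le 0$ on $\Gamma_N$) with $u\le g$ on $\Gamma_D$, then $u\le\overline u$; and if $u\in LSC(\bar\Omega)$ is a viscosity supersolution of the system ($-\Delta_\infty u-\beta|Du|\ge f$ in $\Omega$, $D_\nu u\ge 0$ on $\Gamma_N$) with $u\ge g$ on $\Gamma_D$, then $u\ge\underline u$.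
   Context: Standing setting: $\Omega\subseteq\mathbb{R}^n$ is a bounded, open, connected set with $C^1$ boundary; $\nu$ is the outward unit normal. For some open $A\subseteq\mathbb{R}^n$, $\Gamma_N:=\partial\Omega\cap A$, $\Gamma_D:=\partial\Omega\setminus A\neq\emptyset$. If $\Gamma_N\ne\emptyset$, $\Omega$ is convex. $\beta\in\mathbb{R}$. For $\varphi\in C^2$: $\Delta_\infty^+\varphi(x):=|D\varphi|^{-2}\langle D^2\varphi D\varphi,D\varphi\rangle(x)$ if $D\varphi(x)\ne0$, else $\max_{|v|=1}\langle D^2\varphi(x)v,v\rangle$; $\Delta^-_\infty\varphi:=-\Delta^+_\infty(-\varphi)$. Subsolution: $u$ USC such that for every $\varphi\in C^2(\bar\Omega)$ and $x_0\in\Omega\cup\Gamma_N$ where $u-\varphi$ has a local maximum relative to $\bar\Omega$: $-\Delta^+_\infty\varphi(x_0)-\beta|D\varphi(x_0)|\le f(x_0)$, or $x_0\in\Gamma_N$ and $D\varphi(x_0)\cdot\nu(x_0)\le0$. Supersolution: $v$ LSC such that for every $\varphi\in C^2(\bar\Omega)$ and $x_0\in\Omega\cup\Gamma_N$ where $v-\varphi$ has a local minimum relative to $\bar\Omega$: $-\Delta^-_\infty\varphi(x_0)-\beta|D\varphi(x_0)|\ge f(x_0)$, or $x_0\in\Gamma_N$ and $D\varphi(x_0)\cdot\nu(x_0)\ge0$. A viscosity solution of the system is a continuous function that is both; a solution of the boundary-value problem is additionally equal to $g$ on $\Gamma_D$. *)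

(* Defs.v *)
From HB Require Import structures.
From mathcomp Require Import all_boot all_order all_algebra.
From mathcomp Require Import all_classical all_reals all_analysis.
Set Implicit Arguments. Unset Strict Implicit. Unset Printing Implicit Defensive.
Import Order.TTheory GRing.Theory Num.Theory.
Import numFieldNormedType.Exports.
Local Open Scope classical_set_scope.
Local Open Scope ring_scope.

Section Defs.
Variables (R : realType) (n : nat).
Notation V := 'rV[R]_n.

Definition evec (i : 'I_n) : V := delta_mx 0 i.

Definition dotv (v w : V) : R := \sum_(i < n) v 0 i * w 0 i.
Definition enorm (v : V) : R := Num.sqrt (dotv v v).

Definition partial (i : 'I_n) (phi : V -> R) (x : V) : R := 'D_(evec i) phi x.

Definition grad (phi : V -> R) (x : V) : V := \row_i partial i phi x.
Definition hess (phi : V -> R) (x : V) : 'M[R]_n :=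
  \matrix_(i, j) partial j (partial i phi) x.

Definition quadf (M : 'M[R]_n) (v : V) : R :=
  \sum_(i < n) \sum_(j < n) M i j * v 0 j * v 0 i.

Definition C1 (phi : V -> R) : Prop :=
  (forall x, differentiable phi x) /\ (forall i, continuous (partial i phi)).
Definition C2 (phi : V -> R) : Prop :=
  (forall x, differentiable phi x) /\
  (forall i x, differentiable (partial i phi) x) /\
  (forall i j, continuous (partial j (partial i phi))).

Definition inf_lap_plus (phi : V -> R) (x : V) : R :=
  if grad phi x != 0 then
    (enorm (grad phi x)) ^- 2 * quadf (hess phi x) (grad phi x)
  else sup [set quadf (hess phi x) v | v in [set v : V | enorm v = 1]].
Definition inf_lap_minus (phi : V -> R) (x : V) : R :=
  - inf_lap_plus (fun y => - phi y) x.

Definition bdry (O : set V) : set V := closure O `\` interior O.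

(* O has C^1 boundary and nu is its outward unit normal: locally near every
   boundary point, O = {rho < 0} for a C^1 function rho with nonvanishing
   gradient, and nu = D rho / |D rho| on the boundary. *)
Definition C1_boundary_with_normal (O : set V) (nu : V -> V) : Prop :=
  forall x0, bdry O x0 -> exists r : R, 0 < r /\ exists rho : V -> R,
    C1 rho /\
    (forall y, ball x0 r y -> grad rho y != 0) /\
    (forall y, ball x0 r y -> (O y <-> rho y < 0)) /\
    (forall y, ball x0 r y -> (bdry O y <-> rho y = 0)) /\
    (forall y, ball x0 r y -> bdry O y ->
       nu y = (enorm (grad rho y))^-1 *: grad rho y).

Definition usc_on (D : set V) (u : V -> R) : Prop :=
  forall x, D x -> forall e : R, 0 < e ->
    \forall y \near x, D y -> u y < u x + e.
Definition lsc_on (D : set V) (u : V -> R) : Prop :=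
  forall x, D x -> forall e : R, 0 < e ->
    \forall y \near x, D y -> u x - e < u y.

Definition loc_max_rel (D : set V) (w : V -> R) (x0 : V) : Prop :=
  exists r : R, 0 < r /\ forall y, D y -> ball x0 r y -> w y <= w x0.
Definition loc_min_rel (D : set V) (w : V -> R) (x0 : V) : Prop :=
  exists r : R, 0 < r /\ forall y, D y -> ball x0 r y -> w x0 <= w y.

Variables (Om GN : set V) (nu : V -> V) (beta : R) (f : V -> R).

Definition visc_sub (u : V -> R) : Prop :=
  usc_on (closure Om) u /\
  forall (phi : V -> R) (x0 : V), C2 phi -> (Om `|` GN) x0 ->
    loc_max_rel (closure Om) (fun y => u y - phi y) x0 ->
    (- inf_lap_plus phi x0 - beta * enorm (grad phi x0) <= f x0)
    \/ (GN x0 /\ dotv (grad phi x0) (nu x0) <= 0).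

Definition visc_super (v : V -> R) : Prop :=
  lsc_on (closure Om) v /\
  forall (phi : V -> R) (x0 : V), C2 phi -> (Om `|` GN) x0 ->
    loc_min_rel (closure Om) (fun y => v y - phi y) x0 ->
    (- inf_lap_minus phi x0 - beta * enorm (grad phi x0) >= f x0)
    \/ (GN x0 /\ dotv (grad phi x0) (nu x0) >= 0).

Definition visc_sol (u : V -> R) : Prop :=
  {within closure Om, continuous u} /\ visc_sub u /\ visc_super u.

Definition visc_sol_bvp (GD : set V) (g : V -> R) (u : V -> R) : Prop :=
  visc_sol u /\ forall x, GD x -> u x = g x.

End Defs.

(* Main.v *)
(** Perron's method without a comparison principle. For [k = |beta| + 1] and [C] large, the
cone [C (1 - exp (- k |x - z|))] is a strict supersolution away from its vertex [z], because
[G'' + |beta| G' = - G' < - sup |f|] for [G r = C (1 - exp (- k r)) / k]; when [GN] is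
nonempty, convexity of [Om] gives its normal derivative on [GN] the right sign. Hence every
subsolution lies below [u z + cone], and cones with vertices on [GD] are barriers from both
sides: the subsolutions below [g] on [GD] are uniformly bounded and share a modulus of
continuity, so their supremum is continuous and equals [g] on [GD]. It is a subsolution as a
supremum of subsolutions, and a supersolution because a failing test function could be used
to raise it locally. The minimal solution is obtained from the maximal one through
[u |-> - u], which changes [(beta, f, g)] into [(- beta, - f, - g)]. *)
Require Import Defs.
From HB Require Import structures.
From mathcomp Require Import all_boot all_order all_algebra.
From mathcomp Require Import all_classical all_reals all_analysis.
From mathcomp Require Import ring lra.
Set Implicit Arguments. Unset Strict Implicit. Unset Printing Implicit Defensive.
Import Order.TTheory GRing.Theory Num.Theory.
Import numFieldNormedType.Exports.
Local Open Scope classical_set_scope.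
Local Open Scope ring_scope.

(** Three obstacles shape the argument. Cones are not smooth at their vertices, while test functions
    must be [C2] on the whole space: at each contact point the cone is replaced by a quadratic
    polynomial in |x - z|^2 that touches it from above there and spends only half of the available
    strictness. The operator is discontinuous where the gradient vanishes: strict inequalities for
    test functions still spread to nearby points because [inf_lap_plus] is upper semicontinuous, and
    a smooth piece glued into a subsolution is controlled through [inf_lap_minus], which lies below
    [inf_lap_plus] of any [C2] function touching that piece from above. Finally, the cone height
    needed at points away from the Dirichlet part depends on a lower bound for the subsolution;
    replacing each member of the family by its maximum with one fixed barrier stays in the family,
    does not change the supremum, and supplies a bound common to all members. *)

Section Euclid.
Context {R : realType} {n : nat}.
Implicit Types (x y z v w : 'rV[R]_n).

Lemma dotvC v w : dotv v w = dotv w v.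
Proof. by apply: eq_bigr => i _; rewrite mulrC. Qed.

Lemma dotvDl v1 v2 w : dotv (v1 + v2) w = dotv v1 w + dotv v2 w.
Proof. by rewrite /dotv -big_split; apply: eq_bigr => i _; rewrite mxE mulrDl. Qed.

Lemma dotvZl a v w : dotv (a *: v) w = a * dotv v w.
Proof. by rewrite /dotv mulr_sumr; apply: eq_bigr => i _; rewrite mxE mulrA. Qed.

Lemma dotvNl v w : dotv (- v) w = - dotv v w.
Proof. by rewrite -scaleN1r dotvZl mulN1r. Qed.

Lemma dotvBl v1 v2 w : dotv (v1 - v2) w = dotv v1 w - dotv v2 w.
Proof. by rewrite dotvDl dotvNl. Qed.

Lemma dotvZr a v w : dotv v (a *: w) = a * dotv v w.
Proof. by rewrite dotvC dotvZl dotvC. Qed.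

Lemma dotvNr v w : dotv v (- w) = - dotv v w.
Proof. by rewrite dotvC dotvNl dotvC. Qed.

Lemma dotv0l v : dotv 0 v = 0.
Proof. by rewrite /dotv big1 // => i _; rewrite mxE mul0r. Qed.

Lemma dotv0r v : dotv v 0 = 0.
Proof. by rewrite dotvC dotv0l. Qed.

Lemma dotv_ge0 v : 0 <= dotv v v.
Proof. by apply: sumr_ge0 => i _; rewrite -expr2 sqr_ge0. Qed.

Lemma dotv_gt0 v : (0 < dotv v v) = (v != 0).
Proof.
rewrite lt_def dotv_ge0 andbT; congr (~~ _); apply/eqP/eqP => [h|->]; last first.
  by rewrite /dotv big1 // => i _; rewrite mxE mul0r.
have sq_ge0 (j : 'I_n) : true -> 0 <= v 0 j * v 0 j by rewrite -expr2 sqr_ge0.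
apply/rowP => i; rewrite mxE; apply/eqP; rewrite -sqrf_eq0 expr2; apply/eqP.
exact: (psumr_eq0P sq_ge0 h).
Qed.

Lemma dotv_evec v i : dotv v (evec R i) = v 0 i.
Proof.
rewrite /dotv (bigD1 i) //= big1 ?addr0 => [|j ji].
  by rewrite /evec mxE !eqxx mulr1.
by rewrite /evec mxE (negbTE ji) andbF mulr0.
Qed.

Lemma enorm_ge0 v : 0 <= enorm v. Proof. exact: sqrtr_ge0. Qed.

Lemma enorm_sq v : enorm v ^+ 2 = dotv v v.
Proof. by rewrite sqr_sqrtr // dotv_ge0. Qed.

Lemma enorm_gt0 v : (0 < enorm v) = (v != 0).
Proof. by rewrite sqrtr_gt0 dotv_gt0. Qed.

Lemma enorm0 : enorm (0 : 'rV[R]_n) = 0.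
Proof. by apply/eqP; rewrite eq_le enorm_ge0 leNgt enorm_gt0 eqxx. Qed.

Lemma enormZ a v : enorm (a *: v) = `|a| * enorm v.
Proof.
by rewrite /enorm dotvZl dotvZr mulrA -expr2 sqrtrM ?sqr_ge0 // sqrtr_sqr.
Qed.

Lemma enormN v : enorm (- v) = enorm v.
Proof. by rewrite -scaleN1r enormZ normrN1 mul1r. Qed.

Lemma coord_le_enorm v i : `|v 0 i| <= enorm v.
Proof.
rewrite -sqrtr_sqr ler_wsqrtr // /dotv (bigD1 i) //= -expr2 lerDl.
by apply: sumr_ge0 => j _; rewrite -expr2 sqr_ge0.
Qed.

Lemma ball_coord x y (e : R) : 0 < e -> (forall i, `|x 0 i - y 0 i| < e) -> ball x e y.
Proof. by move=> e0 h; split => // i j; rewrite ord1; exact: h. Qed.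

Lemma enorm_ball x y (e : R) : enorm (x - y) < e -> ball x e y.
Proof.
move=> h; apply: ball_coord => [|i]; first exact: le_lt_trans (enorm_ge0 _) h.
by have := coord_le_enorm (x - y) i; rewrite !mxE => /le_lt_trans; apply.
Qed.

Lemma dotv_cvg {T} {F : set_system T} {FF : Filter F} (f g : T -> 'rV[R]_n)
    (a b : 'rV[R]_n) :
  (forall i, f t 0 i @[t --> F] --> a 0 i) ->
  (forall i, g t 0 i @[t --> F] --> b 0 i) ->
  dotv (f t) (g t) @[t --> F] --> dotv a b.
Proof.
move=> fa gb.
apply: (cvg_big (@add_continuous R)  (Ff := fun i t => f t 0 i * g t 0 i)).
by move=> i _; apply: cvgM; [exact: fa|exact: gb].
Qed.

Definition sqdist z x := dotv (x - z) (x - z).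

Lemma sub_coord_continuous z i : continuous (fun x => (x - z) 0 i : R).
Proof.
have -> : (fun x : 'rV[R]_n => (x - z) 0 i) = (fun x => x 0 i - z 0 i).
  by apply/funext => x; rewrite !mxE.
by move=> x; apply: continuousB; [exact: coord_continuous|exact: cst_continuous].
Qed.

Lemma sqdist_continuous z : continuous (sqdist z).
Proof.
by move=> x; apply: (dotv_cvg (F := nbhs x)) => i; exact: sub_coord_continuous.
Qed.

Lemma enorm_sub_continuous z : continuous (fun x => enorm (x - z)).
Proof.
move=> x.
apply: (@continuous_comp _ _ _ (sqdist z) (@Num.sqrt R) x).
  exact: sqdist_continuous.
exact: sqrt_continuous.
Qed.

End Euclid.

(** * Gradients, Hessians and restrictions to lines *)

Section Calculus.
Context {R : realType} {n : nat}.
Implicit Types (x y z v w : 'rV[R]_n) (phi psi : 'rV[R]_n -> R).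

Lemma differentiable_sum_fun (F : 'I_n -> 'rV[R]_n -> R) x :
  (forall i, differentiable (F i) x) -> differentiable (fun y => \sum_i F i y) x.
Proof. by move=> h; rewrite -fct_sumE; exact: differentiable_sum. Qed.

Lemma is_derive_sum_fun (F : 'I_n -> R -> R) (t : R) (dF : 'I_n -> R) :
  (forall i, is_derive t (1 : R) (F i) (dF i)) ->
  is_derive t (1 : R) (fun s => \sum_i F i s) (\sum_i dF i).
Proof. by move=> h; rewrite -fct_sumE; exact: is_derive_sum. Qed.

Lemma partialE phi x i : differentiable phi x -> partial i phi x = 'd phi x (evec R i).
Proof. exact: deriveE. Qed.

Lemma row_sum_evec v : v = \sum_i v 0 i *: evec R i.
Proof. exact: row_sum_delta. Qed.

Lemma diff_dotv phi x v : differentiable phi x -> 'd phi x v = dotv (grad phi x) v.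
Proof.
move=> dphi; rewrite {1}(row_sum_evec v) linear_sum; apply: eq_bigr => i _.
by rewrite linearZ /= mxE partialE // mulrC.
Qed.

Lemma gradD phi psi x : differentiable phi x -> differentiable psi x ->
  grad (fun y => phi y + psi y) x = grad phi x + grad psi x.
Proof.
move=> dphi dpsi; apply/rowP => i; rewrite !mxE /partial.
by rewrite deriveD //; exact: diff_derivable.
Qed.

Lemma partialN phi i x : differentiable phi x ->
  partial i (fun y => - phi y) x = - partial i phi x.
Proof. by move=> d; rewrite /partial deriveN //; exact: diff_derivable. Qed.

Lemma partialD phi psi i x : differentiable phi x -> differentiable psi x ->
  partial i (fun y => phi y + psi y) x = partial i phi x + partial i psi x.
Proof. by move=> dphi dpsi; rewrite /partial deriveD //; exact: diff_derivable. Qed.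

Lemma C2N phi : C2 phi -> C2 (fun y => - phi y).
Proof.
move=> [d [dd cdd]].
have pE i : partial i (fun y => - phi y) = (fun y => - partial i phi y).
  by apply/funext => x; exact: partialN.
split; [by move=> x; exact: differentiableN|split].
  by move=> i x; rewrite pE; exact: differentiableN.
move=> i j; rewrite pE (_ : partial j _ = (fun y => - partial j (partial i phi) y)).
  by move=> x; apply: continuousN; exact: cdd.
by apply/funext => x; exact: partialN.
Qed.

Lemma C2D phi psi : C2 phi -> C2 psi -> C2 (fun y => phi y + psi y).
Proof.
move=> [d [dd cdd]] [e [ee cee]].
have pE i : partial i (fun y => phi y + psi y) = (fun y => partial i phi y + partial i psi y).
  by apply/funext => x; exact: partialD.
split; [by move=> x; exact: differentiableD|split].
  by move=> i x; rewrite pE; exact: differentiableD.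
move=> i j; rewrite pE.
rewrite (_ : partial j _ = (fun y => partial j (partial i phi) y + partial j (partial i psi) y)).
  by move=> x; apply: continuousD; [exact: cdd|exact: cee].
by apply/funext => x; exact: partialD.
Qed.

Lemma gradN phi x : C2 phi -> grad (fun y => - phi y) x = - grad phi x.
Proof. by move=> [d _]; apply/rowP => i; rewrite !mxE partialN. Qed.

Lemma C2_gradD phi psi x : C2 phi -> C2 psi ->
  grad (fun y => phi y + psi y) x = grad phi x + grad psi x.
Proof. by move=> [d _] [e _]; exact: gradD. Qed.

Lemma hessE phi x i j : hess phi x i j = partial j (partial i phi) x.
Proof. by rewrite mxE. Qed.

Lemma C2_hessD phi psi x : C2 phi -> C2 psi ->
  hess (fun y => phi y + psi y) x = hess phi x + hess psi x.
Proof.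
move=> [d [dd _]] [e [ee _]]; apply/matrixP => i j.
have addE (M N : 'M[R]_n) : (M + N) i j = M i j + N i j by rewrite mxE.
rewrite hessE addE hessE hessE.
rewrite (_ : partial i _ = (fun y => partial i phi y + partial i psi y)) ?partialD//.
by apply/funext => y; exact: partialD.
Qed.

Lemma hessN phi x : C2 phi -> hess (fun y => - phi y) x = - hess phi x.
Proof.
move=> [d [dd _]]; apply/matrixP => i j; rewrite !mxE.
rewrite (_ : partial i _ = (fun y => - partial i phi y)) ?partialN//.
by apply/funext => y; exact: partialN.
Qed.

Lemma quadfD (M N : 'M[R]_n) v : quadf (M + N) v = quadf M v + quadf N v.
Proof.
rewrite /quadf -big_split; apply: eq_bigr => i _; rewrite -big_split.
by apply: eq_bigr => j _; rewrite mxE !mulrDl.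
Qed.

Lemma quadfN (M : 'M[R]_n) v : quadf (- M) v = - quadf M v.
Proof.
rewrite /quadf -sumrN; apply: eq_bigr => i _; rewrite -sumrN.
by apply: eq_bigr => j _; rewrite mxE !mulNr.
Qed.

Lemma quadfZ (M : 'M[R]_n) a v : quadf M (a *: v) = a ^+ 2 * quadf M v.
Proof.
rewrite /quadf mulr_sumr; apply: eq_bigr => i _; rewrite mulr_sumr.
by apply: eq_bigr => j _; rewrite !mxE; ring.
Qed.

Lemma quadfNr (M : 'M[R]_n) v : quadf M (- v) = quadf M v.
Proof. by rewrite -scaleN1r quadfZ sqrrN expr1n mul1r. Qed.

Lemma grad_continuous phi i : C2 phi -> continuous (fun x => grad phi x 0 i).
Proof.
move=> [_ [dd _]] x.
rewrite (_ : (fun y => _) = partial i phi); last by apply/funext => y; rewrite mxE.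
exact: differentiable_continuous.
Qed.

Lemma hess_continuous phi i j : C2 phi -> continuous (fun x => hess phi x i j).
Proof.
move=> [_ [_ cdd]] x.
rewrite (_ : (fun y => _) = partial j (partial i phi)); first exact: cdd.
by apply/funext => y; rewrite mxE.
Qed.

(** Chain rule along a line. Together with [is_derive2_line] it reduces first and second order
    conditions in several variables to one real variable. *)
Lemma is_derive_line phi x v (t : R) : differentiable phi (x + t *: v) ->
  is_derive t (1 : R) (fun s : R => phi (x + s *: v)) (dotv (grad phi (x + t *: v)) v).
Proof.
move=> dphi.
pose l := fun s : R => x + s *: v.
have dl : is_diff t l (fun s : R => s *: v).
  by rewrite /l; apply: is_diff_eq; rewrite add0r.
have dp : is_diff (l t) phi ('d phi (l t)) by exact: DiffDef.
have dc : is_diff t (phi \o l) ('d phi (l t) \o (fun s : R => s *: v)).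
  exact: is_diff_comp.
have dfc : differentiable (phi \o l) t by exact: ex_diff.
split; first exact: diff_derivable.
have e : 'd (phi \o l) t = 'd phi (l t) \o (fun s : R => s *: v) :> (R -> R).
  exact: diff_val.
rewrite deriveE //; transitivity (('d phi (l t) \o (fun s : R => s *: v)) (1 : R)).
  by rewrite -e.
by rewrite /= scale1r diff_dotv.
Qed.

Lemma is_derive2_line phi x v (t : R) : C2 phi ->
  is_derive t (1 : R) (fun s : R => dotv (grad phi (x + s *: v)) v)
    (quadf (hess phi (x + t *: v)) v).
Proof.
move=> [d [dd _]]; rewrite /quadf.
rewrite (_ : (fun s => _) = (fun s : R => \sum_i v 0 i * partial i phi (x + s *: v))); last first.
  by apply/funext => s; apply: eq_bigr => i _; rewrite mxE mulrC.
apply: is_derive_sum_fun => i.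
have := @is_derive_line (partial i phi) x v t (dd i _) => h.
have := is_deriveZ (v 0 i) h => h2.
apply: is_derive_eq h2 _.
rewrite [LHS]mulr_sumr; apply: eq_bigr => j _; rewrite !mxE; ring.
Qed.

End Calculus.

(** * Polynomial test functions of the squared distance *)

Section Quartics.
Context {R : realType} {n : nat}.
Implicit Types (x y z v w : 'rV[R]_n).

Lemma is_derive_coord x v z i :
  is_derive x v (fun y : 'rV[R]_n => (y - z) 0 i : R) (v 0 i).
Proof.
have d1 : differentiable (fun y : 'rV[R]_n => y 0 i : R) x by exact: differentiable_coord.
have e1 : 'D_v (fun y : 'rV[R]_n => y 0 i : R) x = v 0 i.
  have did : derivable (id : 'rV[R]_n -> 'rV[R]_n) x v by exact: derivable_id.
  by have := derive_mx did; rewrite derive_id => /matrixP/(_ 0 i); rewrite mxE.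
have h : is_derive x v (fun y : 'rV[R]_n => y 0 i : R) (v 0 i).
  by rewrite -e1; apply: derivableP; exact: diff_derivable.
rewrite (_ : (fun y => _) = (fun y : 'rV[R]_n => y 0 i - z 0 i)); last first.
  by apply/funext => y; rewrite !mxE.
have hc : is_derive x v (cst (z 0 i) : 'rV[R]_n -> R) 0 by exact: is_derive_cst.
by have := is_deriveB h hc; rewrite subr0.
Qed.

Lemma differentiable_sub_coord x z i :
  differentiable (fun y : 'rV[R]_n => (y - z) 0 i : R) x.
Proof.
rewrite (_ : (fun y => _) = (fun y : 'rV[R]_n => y 0 i - z 0 i)); last first.
  by apply/funext => y; rewrite !mxE.
by apply: differentiableB; [exact: differentiable_coord|exact: differentiable_cst].
Qed.

Lemma differentiable_sqdist z x : differentiable (sqdist z) x.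
Proof.
apply: differentiable_sum_fun => i.
by apply: differentiableM; exact: differentiable_sub_coord.
Qed.

Lemma is_derive_sqdist z x v : is_derive x v (sqdist z) (2 * dotv (x - z) v).
Proof.
rewrite /sqdist /dotv -fct_sumE.
have h i := is_deriveM (is_derive_coord x v z i) (is_derive_coord x v z i).
have := is_derive_sum h => h2; apply: is_derive_eq h2 _.
rewrite mulr_sumr; apply: eq_bigr => i _; rewrite /GRing.scale /=; ring.
Qed.

(* The explicit test functions: second-order polynomials in [|x - z|^2], which are [C2]
   everywhere, whereas cones are singular at their vertex. *)
Definition pq z (s0 b c : R) x :=
  b * (sqdist z x - s0) + c * (sqdist z x - s0) ^+ 2.

Lemma is_derive_pq z s0 b c x v : is_derive x v (pq z s0 b c)
  ((b + 2 * c * (sqdist z x - s0)) * (2 * dotv (x - z) v)).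
Proof.
have h := is_derive_sqdist z x v.
have hc : is_derive x v (cst s0 : 'rV[R]_n -> R) 0 by exact: is_derive_cst.
have h1 := is_deriveB h hc.
have h2 := is_deriveD (is_deriveZ b h1) (is_deriveZ c (is_deriveM h1 h1)).
rewrite (_ : pq z s0 b c = b \*: (sqdist z - cst s0) +
   c \*: ((sqdist z - cst s0) * (sqdist z - cst s0))); last first.
  by apply/funext => y; rewrite /pq expr2.
apply: is_derive_eq h2 _.
rewrite /GRing.scale /= subr0.
rewrite (_ : (sqdist z - cst s0) x = sqdist z x - s0) //; ring.
Qed.

Lemma differentiable_sqdist_affine z s0 b c x :
  differentiable (fun y => b + 2 * c * (sqdist z y - s0)) x.
Proof.
apply: differentiableD; first exact: differentiable_cst.
apply: differentiableM; first exact: differentiable_cst.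
by apply: differentiableB; [exact: differentiable_sqdist|exact: differentiable_cst].
Qed.

Lemma partial_pq z s0 b c i : partial i (pq z s0 b c) =
  (fun x => (b + 2 * c * (sqdist z x - s0)) * (2 * (x - z) 0 i)).
Proof.
apply/funext => x; rewrite /partial.
by have h := is_derive_pq z s0 b c x (evec R i); rewrite derive_val dotv_evec.
Qed.

Lemma partial2_pq z s0 b c i j : partial j (partial i (pq z s0 b c)) =
  (fun x => 8 * c * (x - z) 0 i * (x - z) 0 j +
     2 * (b + 2 * c * (sqdist z x - s0)) * (i == j)%:R).
Proof.
rewrite partial_pq; apply/funext => x; rewrite /partial.
set v := evec R j.
have hc : is_derive x v (cst s0 : 'rV[R]_n -> R) 0 by exact: is_derive_cst.
have hb : is_derive x v (cst b : 'rV[R]_n -> R) 0 by exact: is_derive_cst.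
have h1 := is_deriveD hb (is_deriveZ (2 * c) (is_deriveB (is_derive_sqdist z x v) hc)).
have h2 := is_deriveM h1 (is_deriveZ 2 (is_derive_coord x v z i)).
transitivity ('D_v ((cst b + (2 * c) \*: (sqdist z - cst s0)) *
          (2 \*: (fun y : 'rV[R]_n => (y - z) 0 i : R))) x) => //.
rewrite derive_val dotv_evec.
rewrite /GRing.scale /= /v /evec !mxE eqxx subr0 eq_sym.
rewrite (_ : (cst b + _) x = b + 2 * c * (sqdist z x - s0)) //.
rewrite andTb (_ : 2 *: (x 0 i - z 0 i) = 2 * (x 0 i - z 0 i)) //; ring.
Qed.

Lemma C2_pq z s0 b c : C2 (pq z s0 b c).
Proof.
split; [|split].
- move=> x.
  have d : differentiable (fun y => sqdist z y - s0) x.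
    by apply: differentiableB; [exact: differentiable_sqdist|exact: differentiable_cst].
  rewrite (_ : pq z s0 b c = fun y => b * (sqdist z y - s0) +
     c * ((sqdist z y - s0) * (sqdist z y - s0))); last first.
    by apply/funext => y; rewrite /pq expr2.
  apply: differentiableD; apply: differentiableM => //.
  exact: differentiableM.
- move=> i x; rewrite partial_pq.
  apply: differentiableM; first exact: differentiable_sqdist_affine.
  by apply: differentiableM; [exact: differentiable_cst|exact: differentiable_sub_coord].
- move=> i j; rewrite partial2_pq => x.
  apply: differentiable_continuous; apply: differentiableD.
    apply: differentiableM; last exact: differentiable_sub_coord.
    by apply: differentiableM; [exact: differentiable_cst|exact: differentiable_sub_coord].
  apply: differentiableM; last exact: differentiable_cst.
  by apply: differentiableM; [exact: differentiable_cst|exact: differentiable_sqdist_affine].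
Qed.

Lemma grad_pq z s0 b c x :
  grad (pq z s0 b c) x = (2 * (b + 2 * c * (sqdist z x - s0))) *: (x - z).
Proof. by apply/rowP => i; rewrite mxE partial_pq !mxE; ring. Qed.

(** The Hessian is a rank-one form in x - z plus a multiple of the identity. Only the diagonal
    entries carry the identity part, so they are split off from the double sum. *)
Lemma quadf_hess_pq z s0 b c x v : quadf (hess (pq z s0 b c) x) v =
  8 * c * (dotv (x - z) v) ^+ 2 +
  2 * (b + 2 * c * (sqdist z x - s0)) * dotv v v.
Proof.
set k := 2 * _; pose a i := (x - z) 0 i * v 0 i.
have -> : dotv (x - z) v ^+ 2 = \sum_i \sum_j a i * a j.
  by rewrite expr2 mulr_suml; apply: eq_bigr => i _; rewrite mulr_sumr.
rewrite /quadf /dotv !mulr_sumr -big_split /=; apply: eq_bigr => i _.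
rewrite mulr_sumr (bigD1 i) //= [in RHS](bigD1 i) //= mxE partial2_pq eqxx.
rewrite (eq_bigr (fun j => 8 * c * (a i * a j))) => [|j ji].
  rewrite /a -/k mulr1n; set S := \sum_(j | _) _; move: ((x - z) 0 i) (v 0 i) S k => p q S k; ring.
by rewrite mxE partial2_pq eq_sym (negbTE ji) mulr0 addr0 /a; ring.
Qed.

End Quartics.

(** * First and second derivative tests on the line *)

Section OneVariable.
Context {R : realType}.

Lemma derive_gt0_near (h : R -> R) (t0 d : R) : is_derive t0 (1 : R) h d -> 0 < d ->
  \forall t \near t0, (t0 < t -> h t0 < h t) /\ (t < t0 -> h t < h t0).
Proof.
move=> [dh dv] d0.
have : (s^-1 *: (h (s *: 1 + t0) - h t0) @[s --> 0^']) --> d by rewrite -dv; exact: dh.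
(* Difference quotients at distance less than [d] from their limit [d] are positive. *)
move=> /cvgrPdist_lt/(_ _ d0)/nbhs_ballP[e e0 he].
apply/nbhs_ballP; exists e => // t; rewrite /ball /= => te.
have key : t != t0 -> 0 < (t - t0)^-1 * (h t - h t0).
  move=> tt0; have := he (t - t0); rewrite /ball /= sub0r normrN distrC.
  move=> /(_ te); rewrite subr_eq0 => /(_ tt0).
  rewrite /GRing.scale /= mulr1 subrK ltr_norml => /andP[_]; lra.
split=> tt0.
- have := key (negbT (gt_eqF tt0)).
  by rewrite pmulr_rgt0 ?invr_gt0 subr_gt0.
- have := key (negbT (lt_eqF tt0)).
  by rewrite nmulr_rgt0 ?invr_lt0 ?subr_lt0.
Qed.

(** Since [dh] vanishes at [t0] with positive derivative there, it is negative just before and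
    positive just after; the mean value theorem on each side turns these signs into a strict
    minimum. The second derivative is required at [t0] alone. *)
Lemma second_derivative_gt0_min (h dh : R -> R) (t0 d : R) :
  (\forall t \near t0, is_derive t (1 : R) h (dh t)) -> dh t0 = 0 ->
  is_derive t0 (1 : R) dh d -> 0 < d ->
  \forall t \near t0, t != t0 -> h t0 < h t.
Proof.
move=> hh dh0 hdh d0.
have /nbhs_ballP[e e0 he] := hh.
have /nbhs_ballP[e' e'0 he'] := derive_gt0_near hdh d0.
have m0 : 0 < Num.min e e' by rewrite lt_min e0.
apply/nbhs_ballP; exists (Num.min e e') => // t; rewrite /ball /= lt_min.
move=> /andP[te te'] tt0.
have inb c : `|t0 - c| <= `|t0 - t| -> is_derive c (1:R) h (dh c) /\
    (t0 < c -> 0 < dh c) /\ (c < t0 -> dh c < 0).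
  move=> ct; split; first by apply: he; rewrite /ball /=; exact: le_lt_trans te.
  have [p q] := he' c (le_lt_trans ct te').
  by split=> [/p|/q]; rewrite dh0.
move: tt0; rewrite neq_lt => /orP[] tt0.
- have inI c : c \in `[t, t0] -> `|t0 - c| <= `|t0 - t|.
    by rewrite in_itv /= => /andP[c1 c2]; rewrite !ger0_norm; lra.
  have inO c : c \in `]t, t0[ -> `|t0 - c| <= `|t0 - t|.
    by move=> cI; apply: inI; apply: subset_itv_oo_cc.
  have hc : {within `[t, t0], continuous h}.
    apply: derivable_within_continuous => c cI.
    by have [[dc _] _] := inb c (inI c cI).
  have [c cI hE] := MVT tt0 (fun c cI => (inb c (inO c cI)).1) hc.
  have [_ [_ /(_ _)]] := inb c (inO c cI).
  move: cI; rewrite in_itv /= => /andP[c1 c2] /(_ c2) dc.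
  have : dh c * (t0 - t) < 0 by rewrite nmulr_rlt0 // subr_gt0.
  by rewrite -hE subr_lt0.
- have inI c : c \in `[t0, t] -> `|t0 - c| <= `|t0 - t|.
    by rewrite in_itv /= => /andP[c1 c2]; rewrite !ler0_norm; lra.
  have inO c : c \in `]t0, t[ -> `|t0 - c| <= `|t0 - t|.
    by move=> cI; apply: inI; apply: subset_itv_oo_cc.
  have hc : {within `[t0, t], continuous h}.
    apply: derivable_within_continuous => c cI.
    by have [[dc _] _] := inb c (inI c cI).
  have [c cI hE] := MVT tt0 (fun c cI => (inb c (inO c cI)).1) hc.
  have [_ [/(_ _) + _]] := inb c (inO c cI).
  move: cI; rewrite in_itv /= => /andP[c1 c2] /(_ c1) dc.
  have : 0 < dh c * (t - t0) by rewrite mulr_gt0 // subr_gt0.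
  by rewrite -hE subr_gt0.
Qed.

End OneVariable.

(** * Necessary conditions at a local minimum *)

Section SecondOrder.
Context {R : realType} {n : nat}.
Implicit Types (x y z v w : 'rV[R]_n) (phi psi : 'rV[R]_n -> R).

Lemma line_continuous x v (t : R) : {for t, continuous (fun s : R => x + s *: v)}.
Proof.
by apply: continuousD; [exact: cst_continuous|exact: scalel_continuous].
Qed.

Lemma near_line x v (P : 'rV[R]_n -> Prop) :
  (\forall y \near x, P y) -> \forall t \near (0 : R), P (x + t *: v).
Proof.
have c : (fun s : R => x + s *: v) @ (0 : R) --> x + 0 *: v by exact: line_continuous.
by rewrite scale0r addr0 in c; move=> h; exact: c.
Qed.

(** One-sided on purpose: along an inward direction at the boundary only small positive steps stay
    in the domain. *)
Lemma descent phi x v : differentiable phi x -> dotv (grad phi x) v < 0 ->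
  \forall t \near (0 : R), 0 < t -> phi (x + t *: v) < phi x.
Proof.
move=> d g0.
have d0 : differentiable phi (x + 0 *: v) by rewrite scale0r addr0.
have h := is_deriveN (is_derive_line d0).
have /(derive_gt0_near h) : 0 < - dotv (grad phi (x + 0 *: v)) v.
  by rewrite scale0r addr0 oppr_gt0.
apply: filterS => t [ht _] t0; have := ht t0.
by rewrite [X in X < _]/(- phi _) [X in _ < X]/(- phi _) ltrN2 scale0r addr0.
Qed.

Lemma near_pos_ex (P : R -> Prop) : (\forall t \near (0 : R), P t) ->
  exists2 t, 0 < t & P t.
Proof.
move=> /nbhs_ballP[e /= e0 h]; exists (e / 2); first by rewrite divr_gt0.
by apply: h; rewrite /ball /= sub0r normrN gtr0_norm ?divr_gt0 // ltr_pdivrMr //; lra.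
Qed.

Lemma local_min_grad0 phi x : differentiable phi x ->
  (\forall y \near x, phi x <= phi y) -> grad phi x = 0.
Proof.
move=> d m; apply/eqP/negPn; rewrite -dotv_gt0 -oppr_lt0 -dotvNr; apply/negP => g0.
have [t t0 [/(_ t0)]] := near_pos_ex (filterI (descent d g0) (near_line (- grad phi x) m)).
by move=> h /le_lt_trans/(_ h); rewrite ltxx.
Qed.

(** Negative curvature along [v] would make [x] a strict local minimum of [- phi] on that line,
    because the gradient already vanishes there. *)
Lemma local_min_hess phi x v : C2 phi ->
  (\forall y \near x, phi x <= phi y) -> 0 <= quadf (hess phi x) v.
Proof.
move=> c2 m; rewrite leNgt; apply/negP => q0.
have [d _] := c2.
have g0 := local_min_grad0 (d x) m.
have hN (t : R) := is_deriveN (is_derive_line (d (x + t *: v))).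
have hN2 := is_deriveN (is_derive2_line x v 0 c2).
have hh : \forall t \near (0:R), is_derive t (1 : R)
   (- (fun s : R => phi (x + s *: v))) (- dotv (grad phi (x + t *: v)) v).
  by near=> t; exact: hN.
have z0 : - dotv (grad phi (x + 0 *: v)) v = 0.
  by rewrite scale0r addr0 g0 dotv0l oppr0.
have q1 : 0 < - quadf (hess phi (x + 0 *: v)) v by rewrite scale0r addr0 oppr_gt0.
have H := second_derivative_gt0_min hh z0 hN2 q1.
have [t t0 [/(_ (negbT (gt_eqF t0)))]] := near_pos_ex (filterI H (near_line v m)).
rewrite [X in X < _]/(- phi _) [X in _ < X]/(- phi _) ltrN2 scale0r addr0.
by move=> h /le_lt_trans/(_ h); rewrite ltxx.
Unshelve. all: by end_near. Qed.

Lemma touch_interior (chi psi : 'rV[R]_n -> R) x : C2 chi -> C2 psi ->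
  (\forall y \near x, chi x - psi x <= chi y - psi y) ->
  grad chi x = grad psi x /\
  forall v, quadf (hess psi x) v <= quadf (hess chi x) v.
Proof.
move=> c2 p2 m.
have p2N := C2N p2; have w2 := C2D c2 p2N.
split.
  have := local_min_grad0 (w2.1 x) m; rewrite (C2_gradD x c2 p2N) (gradN x p2).
  by move/eqP; rewrite subr_eq0 => /eqP.
move=> v; have := local_min_hess v w2 m.
by rewrite (C2_hessD x c2 p2N) (hessN x p2) quadfD quadfN subr_ge0.
Qed.

End SecondOrder.

(** * The two infinity Laplacians *)

Section InfLap.
Context {R : realType} {n : nat}.
Implicit Types (x y z v w : 'rV[R]_n) (phi psi : 'rV[R]_n -> R) (M : 'M[R]_n).

Lemma unit_vector_ex : (0 < n)%N -> exists v, enorm v = 1.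
Proof.
case: n => // m _; exists (evec R ord0).
by rewrite /enorm dotv_evec /evec mxE !eqxx sqrtr1.
Qed.

Lemma quadf_le_sum_norm M v : enorm v = 1 -> quadf M v <= \sum_i \sum_j `|M i j|.
Proof.
move=> v1; apply: ler_sum => i _; apply: ler_sum => j _.
apply: le_trans (ler_norm _) _; rewrite !normrM -mulrA ler_piMr //.
by apply: mulr_ile1 => //; rewrite -v1 coord_le_enorm.
Qed.

(** [sup] is meaningful only for nonempty bounded sets: this is the boundedness, and
    [unit_vector_ex] gives nonemptiness in positive dimension. *)
Lemma unit_quadf_has_ubound M :
  has_ubound [set quadf M v | v in [set v | enorm v = 1]].
Proof.
by exists (\sum_i \sum_j `|M i j|) => _ [v v1 <-]; exact: quadf_le_sum_norm.
Qed.

(** Identifies the nonzero-gradient branch of [inf_lap_plus] with a value of the quadratic form on a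
    unit vector, so that both branches obey the same upper bounds. *)
Lemma rayleigh_unit M v : v != 0 ->
  enorm ((enorm v)^-1 *: v) = 1 /\
  (enorm v) ^- 2 * quadf M v = quadf M ((enorm v)^-1 *: v).
Proof.
move=> v0; have e0 : 0 < enorm v by rewrite enorm_gt0.
split; last by rewrite quadfZ exprVn.
by rewrite enormZ ger0_norm ?invr_ge0 ?enorm_ge0 // mulVf // gt_eqF.
Qed.

Lemma inf_lap_plus_ge phi x v : grad phi x = 0 -> enorm v = 1 ->
  quadf (hess phi x) v <= inf_lap_plus phi x.
Proof.
move=> g0 v1; rewrite /inf_lap_plus g0 eqxx /=.
by apply: ub_le_sup; [exact: unit_quadf_has_ubound|exists v].
Qed.

Lemma inf_lap_plus_le phi x (c : R) : (0 < n)%N ->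
  (forall v, enorm v = 1 -> quadf (hess phi x) v <= c) -> inf_lap_plus phi x <= c.
Proof.
move=> n0 h; rewrite /inf_lap_plus; case: ifPn => [g0|_].
  by have [u1 ->] := rayleigh_unit (hess phi x) g0; exact: h.
apply: ge_sup; last by move=> _ [v v1 <-]; exact: h.
by have [v v1] := unit_vector_ex n0; exists (quadf (hess phi x) v), v.
Qed.

(** At a critical point the left side is the least value of one quadratic form on unit vectors and
    the right side the greatest value of a larger form, so any unit vector separates them. Otherwise
    both sides evaluate the forms in the common gradient direction. *)
Lemma inf_lap_minus_le_plus chi psi x : (0 < n)%N -> C2 psi ->
  grad chi x = grad psi x ->
  (forall v, quadf (hess psi x) v <= quadf (hess chi x) v) ->
  inf_lap_minus psi x <= inf_lap_plus chi x.
Proof.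
move=> n0 p2 ge he; have [g0|g0] := eqVneq (grad psi x) 0.
  have [v v1] := unit_vector_ex n0.
  apply: (@le_trans _ _ (quadf (hess psi x) v)); last first.
    by apply: le_trans (he v) _; apply: inf_lap_plus_ge => //; rewrite ge.
  rewrite /inf_lap_minus lerNl -quadfN -(hessN x p2).
  by apply: inf_lap_plus_ge => //; rewrite (gradN x p2) g0 oppr0.
rewrite /inf_lap_minus /inf_lap_plus (gradN x p2) (hessN x p2) oppr_eq0 ge g0.
have qN : quadf (- hess psi x) (- grad psi x) = - quadf (hess psi x) (grad psi x).
  by move: (hess psi x) (grad psi x) => B v; rewrite quadfN quadfNr.
rewrite enormN qN mulrN opprK.
by rewrite ler_pM2l ?he // invr_gt0 exprn_gt0 // enorm_gt0.
Qed.

Lemma enorm_grad_continuous phi : C2 phi -> continuous (fun x => enorm (grad phi x)).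
Proof.
move=> c2 x.
apply: (@continuous_comp _ _ _ (fun y => dotv (grad phi y) (grad phi y)) (@Num.sqrt R) x).
  by apply: (dotv_cvg (F := nbhs x)) => i; exact: grad_continuous.
exact: sqrt_continuous.
Qed.

Lemma sum_continuous (F : 'I_n -> 'rV[R]_n -> R) :
  (forall i, continuous (F i)) -> continuous (fun y => \sum_i F i y).
Proof. by move=> cF; apply: (continuous_big (@add_continuous R)) => i _; exact: cF. Qed.

Lemma mul_continuous (F G : 'rV[R]_n -> R) :
  continuous F -> continuous G -> continuous (fun y => F y * G y).
Proof. by move=> cF cG x; exact: (continuousM (cF x) (cG x)). Qed.

Lemma quadf_hess_grad_continuous phi : C2 phi ->
  continuous (fun x => quadf (hess phi x) (grad phi x)).
Proof.
move=> c2; apply: sum_continuous => i; apply: sum_continuous => j.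
have h := mul_continuous (hess_continuous (i := i) (j := j) c2) (grad_continuous (i := j) c2).
exact: (mul_continuous h (grad_continuous (i := i) c2)).
Qed.

Lemma near_lt_of_continuous (F : 'rV[R]_n -> R) x (a : R) :
  {for x, continuous F} -> F x < a -> \forall y \near x, F y < a.
Proof. by move=> cF Fa; exact: (cvgr_lt _ cF _ Fa). Qed.

Lemma near_gt_of_continuous (F : 'rV[R]_n -> R) x (a : R) :
  {for x, continuous F} -> a < F x -> \forall y \near x, a < F y.
Proof. by move=> cF Fa; exact: (cvgr_gt _ cF _ Fa). Qed.

(** Where the gradient is nonzero the operator is continuous. Where it vanishes, the value at a
    nearby [y] is, in either branch, controlled by the Hessian on unit vectors, hence by the
    supremum at [x] plus the variation [N y] of the Hessian entries. *)
Lemma inf_lap_plus_usc phi x (e : R) : (0 < n)%N -> C2 phi -> 0 < e ->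
  \forall y \near x, inf_lap_plus phi y < inf_lap_plus phi x + e.
Proof.
move=> n0 c2 e0; have [g0|g0] := eqVneq (grad phi x) 0.
  pose N y := \sum_i \sum_j `|hess phi y i j - hess phi x i j|.
  have cN : {for x, continuous N}.
    apply: sum_continuous => i; apply: sum_continuous => j y.
    have ch := hess_continuous (i := i) (j := j) c2 (x := y).
    have cd := continuousB ch (@cst_continuous _ R (hess phi x i j) y).
    exact: (continuous_comp cd (@norm_continuous _ R _)).
  have N0 : N x < e / 2.
    rewrite /N big1 ?divr_gt0 // => i _; rewrite big1 // => j _.
    by rewrite subrr normr0.
  have := near_lt_of_continuous cN N0; apply: filterS => y Ny.
  apply: (@le_lt_trans _ _ (inf_lap_plus phi x + N y)); last first.
    by rewrite ltrD2l; apply: (lt_trans Ny); rewrite ltr_pdivrMr // mulr_natr mulr2n ltrDl.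
  have subE (B C : 'M[R]_n) i j : (B - C) i j = B i j - C i j by rewrite !mxE.
  apply: inf_lap_plus_le => // v v1.
  rewrite -(subrK (hess phi x) (hess phi y)) quadfD addrC lerD //.
    exact: inf_lap_plus_ge.
  apply: le_trans (quadf_le_sum_norm _ v1) _; apply: ler_sum => i _.
  by apply: ler_sum => j _; rewrite subE.
have eg0 : 0 < enorm (grad phi x) by rewrite enorm_gt0.
have cE := enorm_grad_continuous c2.
have cE2 := mul_continuous cE cE.
have E0 : enorm (grad phi x) * enorm (grad phi x) != 0 by rewrite mulf_neq0 // gt_eqF.
have cV := @continuousV _ _ (fun y => enorm (grad phi y) * enorm (grad phi y)) x E0 (cE2 x).
have cQ := continuousM cV (quadf_hess_grad_continuous c2 (x := x)).
set Q := (Q in {for x, continuous Q}) in cQ.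
have QE y : 0 < enorm (grad phi y) -> inf_lap_plus phi y = Q y.
  by rewrite enorm_gt0 /inf_lap_plus => ->; rewrite expr2.
have Qx : Q x < inf_lap_plus phi x + e by rewrite QE // ltrDl.
have n1 := near_lt_of_continuous cQ Qx.
have n2 := near_gt_of_continuous (enorm_grad_continuous c2 (x:=x)) eg0.
by apply: filterS2 n1 n2 => y y1 /QE ->.
Qed.

End InfLap.

(** * Convexity, closure and relative continuity *)

Section Sets.
Context {R : realType} {n : nat}.
Implicit Types (x y z v w : 'rV[R]_n) (O : set 'rV[R]_n).

Lemma convex_segment O x y (t : R) :
  convex_set O -> O x -> O y -> 0 <= t -> t <= 1 -> O (x + t *: (y - x)).
Proof.
move=> cO Ox Oy t0 t1.
have := cO y x (Itv01 t0 t1); rewrite !inE => /(_ Oy Ox).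
rewrite /conv /= /unstable.onem.
by rewrite (_ : t *: y + (1 - t) *: x = x + t *: (y - x)) // scalerBr scalerBl scale1r addrCA.
Qed.

Lemma within_continuousP O (f : 'rV[R]_n -> R) :
  {within O, continuous f} <->
  (forall x, O x -> forall e : R, 0 < e -> \forall y \near x, O y -> `|f x - f y| < e).
Proof.
split=> [/subspace_continuousP h x Ox e e0|h].
  by move/cvgrPdist_lt: (h x Ox) => /(_ e e0).
apply/subspace_continuousP => x Ox; apply/cvgrPdist_lt => e e0.
exact: h.
Qed.

Lemma near_ex_closure O x (P : 'rV[R]_n -> Prop) : closure O x ->
  (\forall y \near x, P y) -> exists2 y, O y & P y.
Proof. by move=> cO /cO [y [Oy Py]]; exists y. Qed.

Lemma closed_bdry O : closed (bdry O).
Proof.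
rewrite /bdry setDE; apply: closedI; first exact: closed_closure.
by apply: open_closedC; exact: open_interior.
Qed.

End Sets.

(** * Geometry at a [C1] boundary *)

Section Domain.
Context {R : realType} {n : nat}.
Implicit Types (x y z v w p : 'rV[R]_n).
Variables (Om : set 'rV[R]_n) (nu : 'rV[R]_n -> 'rV[R]_n).
Hypothesis oOm : open Om.
Hypothesis bdOm : C1_boundary_with_normal Om nu.

Lemma bdry_notin x : bdry Om x -> ~ Om x.
Proof. by move=> [_ h] Ox; apply: h; rewrite (_ : Om° = Om) //; apply/interior_id. Qed.

Lemma closure_dom_or_bdry x : closure Om x -> Om x \/ bdry Om x.
Proof.
move=> cx; have [Ox|nOx] := pselect (Om x); [by left|right; split => //].
by move=> /interior_subset.
Qed.

Lemma dotv_gt0_near (F : 'rV[R]_n -> 'rV[R]_n) (G : 'rV[R]_n -> 'rV[R]_n) x :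
  (forall i, {for x, continuous (fun y => F y 0 i)}) ->
  (forall i, {for x, continuous (fun y => G y 0 i)}) ->
  0 < dotv (F x) (G x) -> \forall y \near x, 0 < dotv (F y) (G y).
Proof.
move=> cF cG; apply: (near_gt_of_continuous (F := fun y => dotv (F y) (G y))).
exact: (dotv_cvg (F := nbhs x) cF cG).
Qed.

(** Only signs of products with [nu] are ever tested, so the normalising factor is relaxed to an
    unspecified positive one. *)
Lemma boundary_chart x0 : bdry Om x0 -> exists rho : 'rV[R]_n -> R,
  [/\ C1 rho, rho x0 = 0,
     0 < dotv (grad rho x0) (nu x0), exists2 a, 0 < a & nu x0 = a *: grad rho x0 &
    \forall y \near x0, [/\ Om y <-> rho y < 0, bdry Om y <-> rho y = 0 &
       bdry Om y -> exists2 a, 0 < a & nu y = a *: grad rho y]].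
Proof.
move=> bx; have [r [r0 [rho [c1 [gn [hO [hB hnu]]]]]]] := bdOm bx.
have an y : ball x0 r y -> bdry Om y -> exists2 a, 0 < a & nu y = a *: grad rho y.
  move=> by0 bOy; exists (enorm (grad rho y))^-1; last exact: hnu.
  by rewrite invr_gt0 enorm_gt0; exact: gn.
have xx := ballxx x0 r0.
have [a a0 nuE] := an x0 xx bx.
exists rho; split => //.
- exact/hB.
- by rewrite nuE dotvZr mulr_gt0 // dotv_gt0; exact: gn.
- by exists a.
- apply/nbhs_ballP; exists r => // y xy.
  by split; [exact: hO|exact: hB|exact: an].
Qed.

Lemma inward_in x0 : bdry Om x0 -> \forall t \near (0 : R), 0 < t -> Om (x0 + t *: - nu x0).
Proof.
move=> bx; have [rho [[d _] rx g0 _ nr]] := boundary_chart bx.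
have g1 : dotv (grad rho x0) (- nu x0) < 0 by rewrite dotvNr oppr_lt0.
apply: filterS2 (descent (d x0) g1) (near_line (- nu x0) nr) => t h1 [h2 _ _] t0.
by apply/h2; rewrite -rx; exact: h1.
Qed.

(** If the inequality failed, [chi - psi] would decrease strictly along the inward normal, which
    enters [Om]. *)
Lemma neumann_touch (chi psi : 'rV[R]_n -> R) x0 : C2 chi -> C2 psi -> bdry Om x0 ->
  (\forall y \near x0, closure Om y -> chi x0 - psi x0 <= chi y - psi y) ->
  dotv (grad chi x0) (nu x0) <= dotv (grad psi x0) (nu x0).
Proof.
move=> c2 p2 bx m; rewrite leNgt; apply/negP => lt.
have p2N := C2N p2; have w2 := C2D c2 p2N.
have g1 : dotv (grad (fun y => chi y - psi y) x0) (- nu x0) < 0.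
  by rewrite (C2_gradD x0 c2 p2N) (gradN x0 p2) dotvNr dotvBl oppr_lt0 subr_gt0.
have [t t0 [h1 [h2 h3]]] := near_pos_ex
  (filterI (descent (w2.1 x0) g1) (filterI (near_line (- nu x0) m) (inward_in bx))).
have := h2 (subset_closure (h3 t0)).
by rewrite leNgt (h1 t0).
Qed.

(** The sign is tested against [grad rho], continuous on the whole space, in place of [nu], which is
    controlled only at boundary points. *)
Lemma near_normal_gt0 phi x0 : C2 phi -> bdry Om x0 -> 0 < dotv (grad phi x0) (nu x0) ->
  \forall y \near x0, bdry Om y -> 0 < dotv (grad phi y) (nu y).
Proof.
move=> c2 bx; have [rho [[_ cr] rx g0 [a a0 ->] nr]] := boundary_chart bx.
rewrite dotvZr pmulr_rgt0 // => h.
have cg i : {for x0, continuous (fun y => grad rho y 0 i)}.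
  by rewrite (_ : (fun y => _) = partial i rho); [exact: cr|apply/funext => y; rewrite mxE].
have := dotv_gt0_near (fun i => grad_continuous (i := i) c2 (x:=x0)) cg h.
apply: filterS2 nr => y [_ _ hy] gy /hy [b b0 ->].
by rewrite dotvZr pmulr_rgt0.
Qed.

(** Were [p] strictly beyond the tangent plane, [rho] would become positive when leaving [x0]
    towards [p]; but by convexity this segment lies in the closure, where [rho <= 0] near [x0]. *)
Lemma convex_normal_ge0 x0 p : convex_set Om -> bdry Om x0 -> Om p ->
  0 <= dotv (x0 - p) (nu x0).
Proof.
move=> cO bx Op; rewrite leNgt; apply/negP => lt.
have [rho [[d _] rx g0 [a a0 nuE] nr]] := boundary_chart bx.
have g1 : dotv (grad (fun y => - rho y) x0) (p - x0) < 0.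
  rewrite (_ : grad _ x0 = - grad rho x0); last first.
    by apply/rowP => i; rewrite !mxE partialN.
  rewrite dotvNl oppr_lt0; move: lt; rewrite nuE dotvZr pmulr_rlt0 // dotvC.
  by rewrite -[x0 - p]opprB dotvNr oppr_lt0.
have dN : differentiable (fun y => - rho y) x0 by exact: differentiableN.
have n1 : \forall t \near (0 : R), t < 1 by exact: lt_nbhsl.
have [t t0 [h1 [[h2 h3 _] t1]]] := near_pos_ex
  (filterI (descent dN g1) (filterI (near_line (p - x0) nr) n1)).
(* [x0] itself is not in [Om]: segments from nearby points [y] of [Om] to [p] approximate this one,
   with distances shrunk by [1 - t]. *)
have cl : closure Om (x0 + t *: (p - x0)).
  move=> B nB.
  have /nbhs_ballP[e e0 eB] := nB.
  have [y Oy [_ xy]] := near_ex_closure bx.1 (nbhsx_ballx x0 e e0).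
  exists (y + t *: (p - y)); split => //.
    by apply: convex_segment => //; exact: ltW.
  apply: eB; apply: ball_coord => // i; have := xy 0 i; rewrite /ball /= !mxE.
  rewrite [X in `|X| < _](_ : _ = (1 - t) * (x0 0 i - y 0 i)); last by ring.
  by apply: le_lt_trans; rewrite normrM ger0_norm ?ler_piMl //; lra.
have rle : rho (x0 + t *: (p - x0)) <= 0.
  by case: (closure_dom_or_bdry cl) => [/h2/ltW//|/h3 ->].
by have := h1 t0; rewrite rx oppr0 oppr_lt0 ltNge rle.
Qed.

(** Openness allows [p] to be pushed to p + t nu; the weak inequality at the new point gains t
    |nu|^2 at [p]. *)
Lemma convex_normal_gt0 x0 p : convex_set Om -> bdry Om x0 -> Om p ->
  0 < dotv (x0 - p) (nu x0).
Proof.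
move=> cO bx Op.
have [rho [_ _ g0 [a a0 nuE] _]] := boundary_chart bx.
have [t t0 Opt] := near_pos_ex (near_line (nu x0) (open_nbhs_nbhs (conj oOm Op))).
have := convex_normal_ge0 cO bx Opt.
rewrite opprD addrA [X in 0 <= X]dotvBl dotvZl subr_ge0; apply: lt_le_trans.
rewrite mulr_gt0 // dotv_gt0; apply/eqP => nu0.
by move: g0; rewrite nu0 dotv0r ltxx.
Qed.

Lemma convex_normal_closure x0 p : convex_set Om -> bdry Om x0 -> closure Om p ->
  0 <= dotv (x0 - p) (nu x0).
Proof.
move=> cO bx cp; rewrite leNgt; apply/negP => lt.
have c : {for p, continuous (fun q : 'rV[R]_n => dotv (q - x0) (nu x0))}.
  apply: (dotv_cvg (F := nbhs p)) => i; first exact: sub_coord_continuous.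
  exact: cvg_cst.
have g0 : 0 < dotv (p - x0) (nu x0) by rewrite -opprB dotvNl oppr_gt0.
have [q Oq] := near_ex_closure cp (near_gt_of_continuous c g0).
rewrite -opprB dotvNl oppr_gt0 ltNge => /negP; apply.
exact: convex_normal_ge0.
Qed.

End Domain.

(** * The cone profile in the squared radius *)

Section Cones.
Context {R : realType}.

(** The variable [s] stands for |x - z|^2, in which [pq] is a polynomial; the radius is its square
    root, smooth away from the vertex. *)
Lemma is_derive_exp_sqrt (k s : R) : 0 < s ->
  is_derive s (1 : R) (fun t => expR (- (k * Num.sqrt t)))
    (- (k * expR (- (k * Num.sqrt s)) * (2 * Num.sqrt s)^-1)).
Proof.
move=> s0.
have hs : is_derive s (1 : R) Num.sqrt (2 * Num.sqrt s)^-1 by exact: is_derive1_sqrt.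
have hk := is_deriveN (is_deriveZ k hs).
have he := is_derive_expR (- (k * Num.sqrt s)).
have h := @is_derive1_comp _ expR (- (k \*: Num.sqrt)) s _ _ he hk.
apply: is_derive_eq h _.
by rewrite /GRing.scale /=; ring.
Qed.

Lemma is_derive_exp_sqrt2 (k s : R) : 0 < s ->
  is_derive s (1 : R) (fun t => k * expR (- (k * Num.sqrt t)) * (2 * Num.sqrt t)^-1)
    (- (k ^+ 2 * expR (- (k * Num.sqrt s)) / (4 * s))
     - k * expR (- (k * Num.sqrt s)) / (4 * s * Num.sqrt s)).
Proof.
move=> s0; have r0 : 0 < Num.sqrt s by rewrite sqrtr_gt0.
have hs : is_derive s (1 : R) Num.sqrt (2 * Num.sqrt s)^-1 by exact: is_derive1_sqrt.
have h1 := is_deriveZ k (is_derive_exp_sqrt k s0).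
have n0 : (2 \*: Num.sqrt) s != 0 by rewrite mulf_neq0 // ?gt_eqF.
have h2 := is_deriveV n0 (is_deriveZ 2 hs).
have h3 := is_deriveM h1 h2.
apply: is_derive_eq h3 _.
have sE : s = Num.sqrt s ^+ 2 by rewrite sqr_sqrtr // ltW.
rewrite [LHS](_ : _ = k * expR (- (k * Num.sqrt s)) *
   (- (2 * Num.sqrt s) ^- 2 * (2 * (2 * Num.sqrt s)^-1)) +
   (2 * Num.sqrt s)^-1 * (k * - (k * expR (- (k * Num.sqrt s)) / (2 * Num.sqrt s)))) //.
move: (expR _) => E; move: (Num.sqrt s) r0 sE => r r0 ->.
by field; rewrite gt_eqF.
Qed.

(** Second order Taylor polynomial of 1 - exp(- k sqrt s) at [s0], with the quadratic coefficient
    raised by [eta] so that it lies above. The combination 2 b + 8 c s0 is the second radial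
    derivative of the associated [pq]: without [eta] it is that of 1 - exp(- k r). *)
Lemma cone_taylor (k s0 eta : R) : 0 < s0 -> 0 < eta ->
  let E := expR (- (k * Num.sqrt s0)) in
  exists b c : R, [/\ b = k * E / (2 * Num.sqrt s0),
    2 * b + 8 * c * s0 = - (k ^+ 2 * E) + 8 * eta * s0 &
    \forall s \near s0, (1 - expR (- (k * Num.sqrt s))) - (1 - E) <=
      b * (s - s0) + c * (s - s0) ^+ 2].
Proof.
move=> s00 eta0 E; have r0 : 0 < Num.sqrt s0 by rewrite sqrtr_gt0.
pose d2 := - (k ^+ 2 * E / (4 * s0)) - k * E / (4 * s0 * Num.sqrt s0).
pose b := k * E / (2 * Num.sqrt s0); pose c := d2 / 2 + eta.
exists b, c; split => //.
  have sE : s0 = Num.sqrt s0 ^+ 2 by rewrite sqr_sqrtr // ltW.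
  rewrite /b /c /d2; move: E (Num.sqrt s0) r0 sE {b c d2} => E r r0 ->.
  by field; rewrite ?(gt_eqF r0) ?andbT.
pose h s := b * (s - s0) + c * ((s - s0) * (s - s0)) + expR (- (k * Num.sqrt s)).
pose dh s := b + 2 * c * (s - s0) - k * expR (- (k * Num.sqrt s)) * (2 * Num.sqrt s)^-1.
have hB (s : R) : is_derive s (1 : R) (fun t : R => t - s0) 1.
  by have := is_deriveB (is_derive_id s (1 : R)) (is_derive_cst s0 s (1 : R)); rewrite subr0.
have hh : \forall s \near s0, is_derive s (1 : R) h (dh s).
  near=> s.
  have sp : 0 < s by near: s; exact: lt_nbhsr.
  have H := is_deriveD (is_deriveD (is_deriveZ b (hB s))
    (is_deriveZ c (is_deriveM (hB s) (hB s)))) (is_derive_exp_sqrt k sp).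
  apply: is_derive_eq H _.
  by rewrite /GRing.scale /= /dh; ring.
have dh0 : dh s0 = 0 by rewrite /dh subrr mulr0 addr0 /b subrr.
have hdh : is_derive s0 (1 : R) dh (2 * eta).
  have hb := is_derive_cst b s0 (1 : R).
  have H := is_deriveB (is_deriveD hb (is_deriveZ (2 * c) (hB s0)))
    (is_derive_exp_sqrt2 k s00).
  apply: is_derive_eq H _.
  by rewrite /GRing.scale /= -/d2 /c; field.
have eta2 : 0 < 2 * eta by rewrite mulr_gt0.
have := second_derivative_gt0_min hh dh0 hdh eta2.
apply: filterS => s hs; have [->|ss] := eqVneq s s0.
  by rewrite !subrr mulr0 expr0n mulr0 addr0.
have := hs ss; rewrite /h !subrr !mulr0 !add0r -/E expr2; lra.
Unshelve. all: by end_near. Qed.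
End Cones.

(** * Cones and their smooth upper contacts *)

Section ConeTest.
Context {R : realType} {n : nat}.
Implicit Types (x y z v w p : 'rV[R]_n).

Definition cone (k C : R) z x : R := C * (1 - expR (- (k * enorm (x - z)))).

Lemma cone_ge0 k C z x : 0 <= k -> 0 <= C -> 0 <= cone k C z x.
Proof.
move=> k0 C0; rewrite /cone mulr_ge0 // subr_ge0 -expR0 ler_expR oppr_le0.
by rewrite mulr_ge0 // enorm_ge0.
Qed.

Lemma cone_vertex k C z : cone k C z z = 0.
Proof. by rewrite /cone subrr enorm0 mulr0 oppr0 expR0 subrr mulr0. Qed.

Lemma coneC k C z x : cone k C z x = cone k C x z.
Proof. by rewrite /cone -(opprB z x) enormN. Qed.

Lemma cone_continuous k C z : continuous (cone k C z).
Proof.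
move=> x; have e := @enorm_sub_continuous R n z x.
have h := continuousM (@cst_continuous _ R (- k) x) e.
have h1 := continuous_comp h (@continuous_expR R _).
have h2 := continuousB (@cst_continuous _ R 1 x) h1.
have h3 := continuousM (@cst_continuous _ R C x) h2.
rewrite (_ : cone k C z = cst C \* (cst 1 \- (expR \o (cst (- k) \* (fun y => enorm (y - z)))))) //.
by apply/funext => y; rewrite /cone /= mulNr.
Qed.

Lemma enorm_sqdist z x : enorm (x - z) = Num.sqrt (sqdist z x).
Proof. by []. Qed.

(** The gradient has length C k E and the infinity Laplacian is C (- k^2 E + k E / 2). Since k =
    |beta| + 1, adding |beta| times the length leaves - C k E / 2, and the lower bound on [C] puts
    this below [- M] up to distance [D]. *)
Lemma cone_test (beta M D : R) : 0 <= M ->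
  let k := `|beta| + 1 in
  forall C, (2 * M + 1) * expR (k * D) <= C ->
  forall z x0, x0 != z -> enorm (x0 - z) <= D ->
  exists b c, let psi := pq z (sqdist z x0) b c in
  [/\ 0 < b, grad psi x0 = (2 * b) *: (x0 - z),
    inf_lap_plus psi x0 + `|beta| * enorm (grad psi x0) < - M &
    \forall y \near x0, cone k C z y - cone k C z x0 <= psi y].
Proof.
move=> M0 k C CM z x0 x0z xD.
set s0 := sqdist z x0; set r := enorm (x0 - z).
have rE : r = Num.sqrt s0 by [].
have r0 : 0 < r by rewrite enorm_gt0 subr_eq0.
have sE : s0 = r ^+ 2 by rewrite rE sqr_sqrtr // dotv_ge0.
have s00 : 0 < s0 by rewrite sE exprn_gt0.
have k1 : 1 <= k by rewrite /k lerDr normr_ge0.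
have k0 : 0 < k by lra.
pose E := expR (- (k * r)).
have E0 : 0 < E by exact: expR_gt0.
have C0 : 0 < C by apply: lt_le_trans CM; rewrite mulr_gt0 ?expR_gt0 //; lra.
(* On distances at most [D] the factor [E] is at least exp(- k D), which explains the exponential in
   the bound on [C]. *)
have CE : 2 * M + 1 <= C * k * E.
  apply: (@le_trans _ _ (C * E)); last first.
    by rewrite mulrAC ler_peMr // mulr_ge0 // ltW.
  apply: (@le_trans _ _ ((2 * M + 1) * expR (k * D) * E)).
    rewrite -mulrA ler_peMr //; first by lra.
    rewrite /E -expRD -expR0 ler_expR subr_ge0.
    by rewrite ler_wpM2l // ltW.
  by rewrite ler_wpM2r // ltW.
(* This [eta] costs 8 eta s0 = k E / 2, half of the gap between k^2 E and |beta| k E. *)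
have eta0 : 0 < k * E / (16 * s0) by rewrite divr_gt0 ?mulr_gt0.
have [b1 [c1 [b1E bc1 tay]]] := cone_taylor k s00 eta0.
rewrite -rE -/E in b1E bc1 tay.
have b10 : 0 < b1 by rewrite b1E divr_gt0 ?mulr_gt0.
have b0 : 0 < C * b1 by rewrite mulr_gt0.
have gE : grad (pq z s0 (C * b1) (C * c1)) x0 = (2 * (C * b1)) *: (x0 - z).
  by rewrite grad_pq -/s0 subrr mulr0 addr0.
exists (C * b1), (C * c1); split => //.
- have g0 : grad (pq z s0 (C * b1) (C * c1)) x0 != 0.
    by rewrite gE -enorm_gt0 enormZ mulr_gt0 // normr_gt0 gt_eqF // mulr_gt0.
  have gn : enorm (grad (pq z s0 (C * b1) (C * c1)) x0) = C * k * E.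
    rewrite gE enormZ ger0_norm; last by rewrite mulr_ge0 // ltW.
    rewrite -/r b1E; field; exact: lt0r_neq0.
  rewrite gn /inf_lap_plus g0.
  have -> : (enorm (grad (pq z s0 (C * b1) (C * c1)) x0)) ^- 2 *
      quadf (hess (pq z s0 (C * b1) (C * c1)) x0) (grad (pq z s0 (C * b1) (C * c1)) x0)
      = C * (2 * b1 + 8 * c1 * s0).
    rewrite quadf_hess_pq -/s0 subrr mulr0 addr0 enorm_sq gE.
    rewrite dotvZl !dotvZr -/(sqdist z x0) -/s0.
    by field; rewrite !gt_eqF.
  rewrite bc1 (_ : 8 * (k * E / (16 * s0)) * s0 = k * E / 2); last first.
    by field; rewrite gt_eqF.
  have -> : C * (- (k ^+ 2 * E) + k * E / 2) + `|beta| * (C * k * E) = - (C * k * E) / 2.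
    by rewrite /k; field.
  lra.
- have ct : {for x0, continuous (sqdist z)} by exact: sqdist_continuous.
  have near_tay : \forall y \near x0, (1 - expR (- (k * Num.sqrt (sqdist z y)))) - (1 - E) <=
      b1 * (sqdist z y - s0) + c1 * (sqdist z y - s0) ^+ 2 by exact: ct tay.
  apply: filterS near_tay => y h.
  by rewrite /cone -mulrBr !enorm_sqdist -/s0 -rE /pq -!mulrA -mulrDr ler_pM2l.
Qed.

End ConeTest.

(** * Upper semicontinuous functions on compact sets *)

Section Semicontinuity.
Context {R : realType} {n : nat}.
Implicit Types (x y z : 'rV[R]_n) (u w phi : 'rV[R]_n -> R) (D K : set 'rV[R]_n).

Lemma usc_on_subset D K u : K `<=` D -> usc_on D u -> usc_on K u.
Proof.
by move=> KD h x Kx e e0; apply: filterS (h x (KD _ Kx) e e0) => y hy /KD /hy.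
Qed.

Lemma usc_on_subr D u phi : continuous phi -> usc_on D u ->
  usc_on D (fun y => u y - phi y).
Proof.
move=> cphi h x Dx e e0.
have e2 : 0 < e / 2 by rewrite divr_gt0.
have l : phi x - e / 2 < phi x by lra.
apply: filterS2 (h x Dx _ e2) (near_gt_of_continuous (cphi x) l) => y h1 h2 Dy.
have := h1 Dy; lra.
Qed.

Lemma usc_on_max D u w : usc_on D u -> usc_on D w ->
  usc_on D (fun y => Num.max (u y) (w y)).
Proof.
move=> hu hw x Dx e e0; apply: filterS2 (hu x Dx e e0) (hw x Dx e e0) => y h1 h2 Dy.
rewrite gt_max (lt_le_trans (h1 Dy)) ?(lt_le_trans (h2 Dy)) //.
  by rewrite lerD2r le_max lexx orbT.
by rewrite lerD2r le_max lexx.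
Qed.

Lemma usc_on_continuous D u : {within D, continuous u} -> usc_on D u.
Proof.
move=> /within_continuousP h x Dx e e0; apply: filterS (h x Dx e e0) => y hy /hy.
by rewrite distrC ltr_norml => /andP[_]; rewrite ltrBlDl.
Qed.

(** The sets [B y] of points with value at least [u y] are totally ordered by inclusion, hence
    generate a proper filter; by semicontinuity each of its cluster points is a maximiser. *)
Lemma usc_attains_max K u : compact K -> K !=set0 -> usc_on K u ->
  exists2 x, K x & forall y, K y -> u y <= u x.
Proof.
move=> cK [x0 Kx0] hu.
pose B y := [set x | K x /\ u y <= u x].
have FF : Filter (filter_from K B).
  apply: filter_from_filter; first by exists x0.
  move=> a b Ka Kb; have [ab|/ltW ba] := leP (u a) (u b).
    by exists b => // x [Kx ux]; split; split => //; exact: le_trans ux.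
  by exists a => // x [Kx ux]; split; split => //; exact: le_trans ux.
have PF : ProperFilter (filter_from K B).
  by apply: filter_from_proper => y Ky; exists y; split.
have [|x [Kx clx]] := cK _ PF; first by exists x0 => // x [].
exists x => // y Ky; rewrite leNgt; apply/negP => xy.
have e0 : 0 < u y - u x by rewrite subr_gt0.
have [z [[Kz uz] /(_ Kz)]] := clx _ _ (ex_intro2 _ _ y Ky (fun a h => h)) (hu x Kx _ e0).
by rewrite addrC subrK ltNge uz.
Qed.

End Semicontinuity.

(** * Pointwise subsolution conditions and strict test functions *)

Section Viscosity.
Context {R : realType} {n : nat}.
Implicit Types (x y z v p : 'rV[R]_n) (u w phi psi chi : 'rV[R]_n -> R).
Variables (Om : set 'rV[R]_n) (nu : 'rV[R]_n -> 'rV[R]_n) (A : set 'rV[R]_n).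
Hypothesis oOm : open Om.
Hypothesis bdOm : C1_boundary_with_normal Om nu.
Hypothesis n0 : (0 < n)%N.
Notation GN := (bdry Om `&` A).
Notation GD := (bdry Om `\` A).
Notation S := (Om `|` GN).

Lemma S_closure x : S x -> closure Om x.
Proof. by case=> [/subset_closure //|[[]]]. Qed.

Lemma closure_S_or_GD x : closure Om x -> S x \/ GD x.
Proof.
move=> /closure_dom_or_bdry[Ox|bx]; first by left; left.
by have [Ax|nAx] := pselect (A x); [left; right|right].
Qed.

Lemma S_notin_GD x : S x -> ~ GD x.
Proof. by case=> [Ox [/(bdry_notin oOm)] //|[_ Ax] [_]]. Qed.

Section Operator.
Variables (beta : R) (f : 'rV[R]_n -> R).

(** Stated at a single point, so that a function assembled from several subsolutions can be checked
    against a different one at each point. *)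
Definition sub_at u x := forall phi, C2 phi ->
  (\forall y \near x, closure Om y -> u y - phi y <= u x - phi x) ->
  - inf_lap_plus phi x - beta * enorm (grad phi x) <= f x
  \/ (GN x /\ dotv (grad phi x) (nu x) <= 0).

Lemma visc_subP u : visc_sub Om GN nu beta f u <->
  usc_on (closure Om) u /\ forall x, S x -> sub_at u x.
Proof.
split=> -[uu h]; split => //.
- move=> x Sx phi c2 m; apply: h => //.
  have /nbhs_ballP[r r0 rm] := m.
  by exists r; split => // y Dy xy; exact: rm.
- move=> phi x c2 Sx [r [r0 m]]; apply: h => //.
  by apply/nbhs_ballP; exists r => // y xy Dy; exact: m.
Qed.

Lemma sub_at_le u w x : (\forall y \near x, closure Om y -> w y - w x <= u y - u x) ->
  sub_at w x -> sub_at u x.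
Proof.
move=> wle h phi c2 m; apply: h => //; apply: filterS2 wle m => y h1 h2 cy.
have := h1 cy; have := h2 cy; lra.
Qed.

(** The exact negation of the alternative in [sub_at]; hence [inf_lap_plus] appears here, although
    it describes a supersolution. *)
Definition strict_super phi x :=
  f x < - inf_lap_plus phi x - beta * enorm (grad phi x) /\
  (GN x -> 0 < dotv (grad phi x) (nu x)).

Lemma strict_super_no_max u phi x : C2 phi -> strict_super phi x -> sub_at u x ->
  ~ (\forall y \near x, closure Om y -> u y - phi y <= u x - phi x).
Proof.
move=> c2 [h1 h2] su m; case: (su phi c2 m) => [|[/h2]]; first by rewrite leNgt h1.
by move=> h3; rewrite leNgt h3.
Qed.

Lemma perturbed_lt (a b d e a' b' d' : R) : (- a - b) - d = 3 * e -> a' < a + e ->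
  b' < b + e -> `|d - d'| < e -> d' < - a' - b'.
Proof. by rewrite ltr_norml => h1 h2 h3 /andP[h4 _]; lra. Qed.

(** Upper semicontinuity of [inf_lap_plus] is the direction required. The Neumann clause is vacuous
    near interior points and persists near boundary points by [near_normal_gt0]. *)
Lemma strict_super_near phi x : C2 phi -> S x -> {within S, continuous f} ->
  strict_super phi x -> \forall y \near x, S y -> strict_super phi y.
Proof.
move=> c2 Sx /within_continuousP cf [h1 h2].
set L := - inf_lap_plus phi x - beta * enorm (grad phi x) in h1.
(* One third of the gap for each varying term: the infinity Laplacian, the drift and [f]. *)
pose e := (L - f x) / 3.
have e0 : 0 < e by rewrite divr_gt0 // subr_gt0.
have ce := continuousM (@cst_continuous _ R beta x) (enorm_grad_continuous c2 (x := x)).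
have l : beta * enorm (grad phi x) < beta * enorm (grad phi x) + e by rewrite ltrDl.
have near_e : \forall y \near x, beta * enorm (grad phi y) < beta * enorm (grad phi x) + e.
  exact: near_lt_of_continuous ce l.
have near_nu : \forall y \near x, S y -> GN y -> 0 < dotv (grad phi y) (nu y).
  case: (Sx) => [Ox|GNx].
    apply: filterS (open_nbhs_nbhs (conj oOm Ox)) => y Oy _ [by_ _].
    by case: (bdry_notin oOm by_).
  by apply: filterS (near_normal_gt0 bdOm c2 GNx.1 (h2 GNx)) => y hy _ [/hy].
near=> y => Sy; split; last first.
  by apply: (near near_nu).
have i1 : inf_lap_plus phi y < inf_lap_plus phi x + e.
  by near: y; exact: inf_lap_plus_usc.
have i2 : beta * enorm (grad phi y) < beta * enorm (grad phi x) + e.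
  by near: y.
have i3 : `|f x - f y| < e.
  by move: Sy; near: y; exact: cf.
have eE : L - f x = 3 * e by rewrite /e mulrC divfK.
exact: (perturbed_lt eE i1 i2 i3).
Unshelve. all: by end_near. Qed.

(** A test function touching [psi] from above has [inf_lap_plus] at least [inf_lap_minus psi]. At
    points of [GN] it inherits the Neumann sign instead, which settles the alternative there. *)
Lemma classical_sub_at psi x : C2 psi -> S x ->
  - inf_lap_minus psi x - beta * enorm (grad psi x) <= f x ->
  (GN x -> dotv (grad psi x) (nu x) <= 0) -> sub_at psi x.
Proof.
move=> p2 Sx h1 h2 phi c2 m.
case: (Sx) => [Ox|GNx].
  left; have m' : \forall y \near x, phi x - psi x <= phi y - psi y.
    apply: filterS2 m (open_nbhs_nbhs (conj oOm Ox)) => y hy Oy.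
    have := hy (subset_closure Oy); lra.
  have [ge he] := touch_interior c2 p2 m'.
  apply: le_trans h1; rewrite ge lerD2r lerN2.
  exact: inf_lap_minus_le_plus.
right; split => //; apply: le_trans (h2 GNx).
apply: (neumann_touch bdOm c2 p2 GNx.1).
by apply: filterS m => y hy /hy; lra.
Qed.

(** At a maximum point of [u - phi] the second alternative is impossible, since [psi] would then be
    a strict test function touching [u] from above; so [u <= phi] there, hence everywhere. Passing
    through [psi] allows a merely continuous [phi]. *)
Lemma comparison u phi x : compact (closure Om) -> visc_sub Om GN nu beta f u ->
  continuous phi ->
  (forall x0, closure Om x0 -> u x0 <= phi x0 \/
     (S x0 /\ exists psi, [/\ C2 psi, strict_super psi x0 &
        \forall y \near x0, phi y - phi x0 <= psi y - psi x0])) ->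
  closure Om x -> u x <= phi x.
Proof.
move=> cO /visc_subP[uu su] cphi h cx.
have [x0 cx0 mx] := usc_attains_max cO (ex_intro _ x cx) (usc_on_subr cphi uu).
have /mx m := cx; suff : u x0 <= phi x0 by lra.
case: (h x0 cx0) => // -[Sx0 [psi [p2 sp np]]]; exfalso.
apply: (strict_super_no_max p2 sp (su _ Sx0)).
by apply: filterS np => y hy /mx; lra.
Qed.

End Operator.

End Viscosity.

(** * Suprema of subsolutions and local bumps *)

Section Envelope.
Context {R : realType} {n : nat}.
Implicit Types (x y z p : 'rV[R]_n) (u w phi psi chi : 'rV[R]_n -> R).

(** [ball] is taken in the maximum norm, whereas the quartic perturbations measure Euclidean
    distance. *)
Lemma near_sqdist x (P : 'rV[R]_n -> Prop) : (\forall y \near x, P y) ->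
  exists2 r : R, 0 < r & forall y, sqdist x y < r -> P y.
Proof.
move=> /nbhs_ballP[e /= e0 h]; exists (e ^+ 2); first by rewrite exprn_gt0.
move=> y; rewrite /sqdist -enorm_sq ltr_sqr ?nnegrE ?enorm_ge0 ?(ltW e0) // => ye.
by apply: h; apply: enorm_ball; rewrite -opprB enormN.
Qed.

Lemma sqdist_ge0 x y : 0 <= sqdist x y. Proof. exact: dotv_ge0. Qed.

Lemma sqdist_self x : sqdist x x = 0.
Proof. by rewrite /sqdist subrr dotv0l. Qed.

Lemma pq_quartic x y : pq x 0 0 1 y = sqdist x y ^+ 2.
Proof. by rewrite /pq mul0r add0r mul1r subr0. Qed.

Lemma grad_quartic phi x : C2 phi -> grad (fun y => phi y + pq x 0 0 1 y) x = grad phi x.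
Proof.
move=> c2; rewrite (C2_gradD x c2 (C2_pq x 0 0 1)) grad_pq sqdist_self.
by rewrite !subrr scaler0 addr0.
Qed.

Lemma hess_quartic phi x : C2 phi -> hess (fun y => phi y + pq x 0 0 1 y) x = hess phi x.
Proof.
move=> c2; rewrite (C2_hessD x c2 (C2_pq x 0 0 1)) -[RHS]addr0; congr (_ + _).
apply/matrixP => i j; rewrite !mxE partial2_pq sqdist_self !mxE.
by rewrite !(subrr, mulr0, mul0r, addr0, add0r).
Qed.

Variables (Om : set 'rV[R]_n) (nu : 'rV[R]_n -> 'rV[R]_n) (A : set 'rV[R]_n).
Notation GN := (bdry Om `&` A).
Notation GD := (bdry Om `\` A).
Notation S := (Om `|` GN).
Notation cOm := (closure Om).
Hypothesis oOm : open Om.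
Hypothesis bdOm : C1_boundary_with_normal Om nu.
Hypothesis n0 : (0 < n)%N.
Hypothesis oA : open A.

Lemma closed_dirichlet : closed GD.
Proof.
by rewrite setDE; apply: closedI; [exact: closed_bdry|exact: open_closedC].
Qed.

Lemma near_notin_dirichlet x : S x -> \forall y \near x, ~ GD y.
Proof.
move=> Sx; have oGD : open (~` GD) by apply: closed_openC; exact: closed_dirichlet.
exact: (open_nbhs_nbhs (conj oGD (S_notin_GD oOm Sx))).
Qed.

Lemma strict_super_quartic beta f phi x : C2 phi ->
  strict_super Om nu A beta f phi x ->
  strict_super Om nu A beta f (fun y => phi y + pq x 0 0 1 y) x.
Proof.
move=> c2; rewrite /strict_super /inf_lap_plus.
by rewrite (grad_quartic x c2) (hess_quartic x c2).
Qed.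

(** A test function violating the alternative is strict near [x0], also after adding |x - x0|^4. For
    a member [u] close enough to [U] at [x0], the quartic term keeps the maximum of [u - psi] on a
    small ball off its sphere, giving a contact that strictness excludes. *)
Lemma sup_sub_at (beta : R) (f : 'rV[R]_n -> R) (F : set ('rV[R]_n -> R)) U x0 :
  compact cOm -> {within S, continuous f} ->
  (forall u, F u -> visc_sub Om GN nu beta f u) ->
  (forall u x, F u -> cOm x -> u x <= U x) ->
  (forall e : R, 0 < e -> exists2 u, F u & U x0 - e < u x0) ->
  S x0 -> sub_at Om nu A beta f U x0.
Proof.
move=> cK cf Fsub FU adh Sx0 phi c2 m.
have [//|] := pselect (- inf_lap_plus phi x0 - beta * enorm (grad phi x0) <= f x0
  \/ GN x0 /\ dotv (grad phi x0) (nu x0) <= 0).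
move=> /not_orP[/negP h1 /not_andP h2]; exfalso.
have st : strict_super Om nu A beta f phi x0.
  split; first by rewrite ltNge.
  by move=> GNx; case: h2 => // /negP; rewrite -ltNge.
have p2 := C2D c2 (C2_pq x0 0 0 1).
have near_st := strict_super_near oOm bdOm n0 p2 Sx0 cf (strict_super_quartic c2 st).
have [r r0 hr] := near_sqdist (filterI m (filterI near_st (near_notin_dirichlet Sx0))).
set psi := (fun y => phi y + pq x0 0 0 1 y) in p2 near_st hr.
(* [rho] bounds the squared distance, so the quartic term equals [rho ^+ 2] on the sphere; this is
   the tolerance allowed for [u] at [x0]. *)
pose rho := r / 2.
have rho0 : 0 < rho by rewrite divr_gt0.
have rho_r : rho < r by rewrite /rho ltr_pdivrMr // mulr_natr mulr2n ltrDl.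
pose K := cOm `&` [set y | sqdist x0 y <= rho].
have cKK : compact K.
  apply: compact_closedI => //.
  apply: (@closed_comp _ _ (sqdist x0) [set t | t <= rho]); last exact: closed_le.
  by move=> y _; exact: sqdist_continuous.
have cx0 := S_closure Sx0.
have Kx0 : K x0 by split => //=; rewrite sqdist_self ltW.
have [u Fu ux0] := adh (rho ^+ 2) (exprn_gt0 2 rho0).
have su := Fsub u Fu.
have uscK : usc_on K (fun y => u y - psi y).
  apply: usc_on_subr; last by apply: usc_on_subset su.1 => y [].
  by move=> y; apply: differentiable_continuous; exact: p2.1.
have [x1 [cx1 s1] mx1] := usc_attains_max cKK (ex_intro _ x0 Kx0) uscK.
rewrite /= in s1.
have [hU [hst nGD]] := hr x1 (le_lt_trans s1 rho_r).
have Sx1 : S x1 by case: (closure_S_or_GD A cx1).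
have psi0 : psi x0 = phi x0 by rewrite /psi pq_quartic sqdist_self expr0n addr0.
have s1lt : sqdist x0 x1 < rho.
  rewrite lt_neqAle s1 andbT; apply/eqP => s1E.
  have := mx1 x0 Kx0; rewrite psi0 /psi pq_quartic s1E => a1.
  have a2 := hU cx1; have a3 := FU u x1 Fu cx1.
  move: (rho ^+ 2) (u x0) (u x1) (phi x0) (phi x1) (U x0) (U x1) ux0 a1 a2 a3.
  by move=> *; lra.
apply: (strict_super_no_max p2 (hst Sx1)); first exact: (proj2 ((visc_subP _ _ _ _ _ u).1 su)).
have near_in := near_lt_of_continuous (@sqdist_continuous R n x0 x1) s1lt.
by apply: filterS near_in => y /ltW ys cy; exact: mx1.
Qed.

(* The bump is [phi - |x - x0|^4] plus a constant: the quartic term changes neither the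
   gradient nor the Hessian at [x0] and makes the contact strict. *)
Lemma perron_bump (beta : R) (f : 'rV[R]_n -> R) U phi x0 :
  {within S, continuous f} -> {within cOm, continuous U} ->
  visc_sub Om GN nu beta f U -> C2 phi -> S x0 ->
  (\forall y \near x0, cOm y -> U x0 - phi x0 <= U y - phi y) ->
  - inf_lap_minus phi x0 - beta * enorm (grad phi x0) < f x0 ->
  (GN x0 -> dotv (grad phi x0) (nu x0) < 0) ->
  exists v, [/\ visc_sub Om GN nu beta f v, forall x, GD x -> v x = U x & U x0 < v x0].
Proof.
move=> cf cU sU c2 Sx0 m h1 h2.
have c2N := C2N c2.
(* A failed supersolution test by [phi] is a strict test by [- phi] for the reflected data, so the
   stability of [strict_super] applies. *)
have st : strict_super Om nu A (- beta) (fun y => - f y) (fun y => - phi y) x0.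
  split; last by move=> /h2; rewrite (gradN x0 c2) dotvNl oppr_gt0.
  move: h1; rewrite /inf_lap_minus (gradN x0 c2) enormN.
  by move: (inf_lap_plus _ _) (enorm _) (f x0) => a b c; lra.
have cfN : {within S, continuous (fun y => - f y)}.
  apply/within_continuousP => y Sy e e0.
  move/within_continuousP: cf => /(_ y Sy e e0); apply: filterS => z hz /hz.
  by rewrite -opprD normrN.
have p2 := C2D c2N (C2_pq x0 0 0 1).
have near_st := strict_super_near oOm bdOm n0 p2 Sx0 cfN (strict_super_quartic c2N st).
have [r r0 hr] := near_sqdist (filterI m (filterI near_st (near_notin_dirichlet Sx0))).
set psiN := (fun y => - phi y + pq x0 0 0 1 y) in p2 near_st hr.
pose psi y := - psiN y.
have psi2 : C2 psi := C2N p2.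
pose rho := r / 2.
have rho0 : 0 < rho by rewrite divr_gt0.
have rho_r : rho < r by rewrite /rho ltr_pdivrMr // mulr_natr mulr2n ltrDl.
(* Positive, to lift the bump above [U] at [x0]; less than [rho ^+ 2], to keep it below [U] once the
   squared distance reaches [rho]. *)
pose eta := rho ^+ 2 / 2.
have eta0 : 0 < eta by rewrite divr_gt0 // exprn_gt0.
have eta_rho : eta < rho ^+ 2.
  by rewrite /eta ltr_pdivrMr // mulr_natr mulr2n ltrDl exprn_gt0.
pose B y := psi y + (U x0 - phi x0 + eta).
have BE y : B y = phi y - sqdist x0 y ^+ 2 + (U x0 - phi x0 + eta).
  by rewrite /B /psi /psiN pq_quartic opprD opprK.
(* On the part of the closure where [rho <= sqdist x0 y < r] the maximum is already [U y], so the
   cut at [r] creates no jump. *)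
pose v y := if sqdist x0 y < r then Num.max (U y) (B y) else U y.
have v_ge y : U y <= v y by rewrite /v; case: ifP => // _; rewrite le_max lexx.
have B_small y : cOm y -> rho <= sqdist x0 y -> sqdist x0 y < r -> B y < U y.
  move=> cy y1 y2; have [hU _] := hr y y2.
  have rr : rho ^+ 2 <= sqdist x0 y ^+ 2 by rewrite ler_sqr ?nnegrE ?sqdist_ge0 ?(ltW rho0).
  by rewrite BE; have := hU cy; lra.
have vU y : cOm y -> rho <= sqdist x0 y -> v y = U y.
  move=> cy y1; rewrite /v; case: ifP => // y2.
  by apply/max_idPl/ltW; exact: B_small.
have cB : continuous B.
  move=> y; have cpsi := differentiable_continuous (psi2.1 y).
  exact: (continuousD cpsi (@cst_continuous _ R (U x0 - phi x0 + eta) y)).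
have uscU := usc_on_continuous cU.
have uscB : usc_on cOm B.
  move=> y _ e e0; have l : B y < B y + e by rewrite ltrDl.
  by apply: filterS (near_lt_of_continuous (cB y) l) => z hz _.
have near_in y : sqdist x0 y < r -> \forall z \near y, sqdist x0 z < r.
  exact: (near_lt_of_continuous (@sqdist_continuous R n x0 y)).
have uscv : usc_on cOm v.
  move=> y cy e e0; have [yr|yr] := ltP (sqdist x0 y) r.
    apply: filterS2 (near_in y yr) (usc_on_max uscU uscB cy e0) => z zr hz cz.
    by rewrite /v zr yr; exact: hz.
  have yrho := lt_le_trans rho_r yr.
  apply: filterS2 (near_gt_of_continuous (@sqdist_continuous R n x0 y) yrho) (uscU y cy e e0).
  move=> z zr hz cz; rewrite (vU z cz (ltW zr)) (vU y cy (ltW yrho)); exact: hz.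
exists v; split; last 2 first.
- move=> y [by_ nAy]; rewrite /v; case: ifP => // yr.
  by have [_ [_ nGD]] := hr y yr; case: nGD.
- rewrite /v sqdist_self r0 lt_max BE sqdist_self expr0n subr0; apply/orP; right.
  by lra.
apply/visc_subP; split => // y Sy.
(* Where [v] agrees with [U], a test from above touches [U] as well; elsewhere it touches the bump,
   a classical subsolution. *)
have [yE|yNE] := eqVneq (v y) (U y).
  apply: (sub_at_le _ (proj2 ((visc_subP _ _ _ _ _ U).1 sU) y Sy)).
  by near=> z => _; rewrite yE lerD2r.
have yr : sqdist x0 y < r by apply: contraT => nyr; move: yNE; rewrite /v (negbTE nyr) eqxx.
have vB : v y = B y.
  move: yNE; rewrite /v yr; case: (leP (U y) (B y)) => //.
  by rewrite eqxx.
apply: (sub_at_le (w := psi)).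
  apply: filterS (near_in y yr) => z zr _; rewrite vB /v zr.
  have : B z <= Num.max (U z) (B z) by rewrite le_max lexx orbT.
  by rewrite /B; lra.
have [_ [hst _]] := hr y yr; have [s1 s2] := hst Sy.
apply: (classical_sub_at oOm bdOm n0 psi2 Sy); last first.
  by move=> /s2; rewrite /psi (gradN y p2) dotvNl oppr_le0 => /ltW.
rewrite /inf_lap_minus /psi (gradN y p2) enormN.
rewrite (_ : (fun y => - - psiN y) = psiN); last by apply/funext => z; rewrite opprK.
by lra.
Unshelve. all: by end_near. Qed.

End Envelope.

(** * Reflection between subsolutions and supersolutions *)

Lemma lsc_on_oppr {R : realType} {n : nat} (D : set 'rV[R]_n) (v : 'rV[R]_n -> R) :
  lsc_on D v <-> usc_on D (fun x => - v x).
Proof.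
by split=> h x Dx e e0; apply: filterS (h x Dx e e0) => y hy /hy; lra.
Qed.

Lemma within_continuousN {R : realType} {n : nat} (D : set 'rV[R]_n) (u : 'rV[R]_n -> R) :
  {within D, continuous u} -> {within D, continuous (fun x => - u x)}.
Proof.
move=> /within_continuousP h; apply/within_continuousP => x Dx e e0.
by apply: filterS (h x Dx e e0) => y hy /hy; rewrite -opprD normrN.
Qed.

Lemma visc_super_oppr {R : realType} {n : nat} (Om GN : set 'rV[R]_n)
    (nu : 'rV[R]_n -> 'rV[R]_n) (beta : R) (f v : 'rV[R]_n -> R) :
  visc_super Om GN nu beta f v <->
  visc_sub Om GN nu (- beta) (fun x => - f x) (fun x => - v x).
Proof.
split=> -[/lsc_on_oppr sc h]; split => // phi x c2 Sx [r [r0 m]].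
- have m' : loc_min_rel (closure Om) (fun y => v y - - phi y) x.
    by exists r; split => // y cy xy; have := m y cy xy; lra.
  have := h _ x (C2N c2) Sx m'.
  rewrite /inf_lap_minus (gradN x c2) enormN.
  rewrite (_ : (fun y => - - phi y) = phi); last by apply/funext => y; rewrite opprK.
  by case=> [h1|[GNx]]; [left; lra|rewrite dotvNl oppr_ge0; right].
- have m' : loc_max_rel (closure Om) (fun y => - v y - - phi y) x.
    by exists r; split => // y cy xy; have := m y cy xy; lra.
  have := h _ x (C2N c2) Sx m'.
  rewrite /inf_lap_minus (gradN x c2) enormN.
  by case=> [h1|[GNx]]; [left; lra|rewrite dotvNl oppr_le0; right].
Qed.

(** * Bounds on compact sets *)

Section Boundedness.
Context {R : realType} {n : nat}.
Implicit Types (x y z : 'rV[R]_n) (u : 'rV[R]_n -> R) (O K : set 'rV[R]_n).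

Lemma bounded_closure O : bounded_set O -> bounded_set (closure O).
Proof.
move=> [M [Mr h]]; exists (M + 2); split=> [|N MN x cx]; first by rewrite realD // realn.
have hM : M < M + 1 by rewrite ltrDl.
have [y Oy xy] := near_ex_closure cx (nbhsx_ballx x (1 : R) ltr01).
have := h _ hM y Oy; rewrite /= => yM.
move: xy; rewrite -ball_normE /= => xy.
have := ler_normD (x - y) y; rewrite subrK; lra.
Qed.

Lemma bounded_enorm_sub K : bounded_set K ->
  exists D : R, forall x y, K x -> K y -> enorm (x - y) <= D.
Proof.
move=> [M [Mr h]]; have hM : M < M + 1 by rewrite ltrDl.
have cb x i : K x -> `|x 0 i| <= M + 1.
  move=> Kx; apply: le_trans (h _ hM x Kx); rewrite [leRHS]/Num.Def.normr /= mx_normrE.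
  exact: (le_bigmax _ (fun ij => `|x ij.1 ij.2|) (0, i)).
exists (Num.sqrt (\sum_(i < n) (2 * (M + 1)) ^+ 2)) => x y Kx Ky.
apply: ler_wsqrtr; apply: ler_sum => i _; rewrite -expr2 -[leLHS]real_normK ?num_real //.
rewrite ler_sqr ?nnegrE //; last first.
  by have := le_trans (normr_ge0 _) (cb x i Kx); lra.
have := ler_normB (x 0 i) (y 0 i); rewrite !mxE.
have := cb x i Kx; have := cb y i Ky; lra.
Qed.

Lemma compact_continuous_bounded K u : compact K -> K !=set0 -> {within K, continuous u} ->
  exists G : R, forall x, K x -> `|u x| <= G.
Proof.
move=> cK K0 cu.
have [a Ka ha] := usc_attains_max cK K0 (usc_on_continuous cu).
have cuN : {within K, continuous (fun x => - u x)}.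
  apply/within_continuousP => x Kx e e0.
  move/within_continuousP: cu => /(_ x Kx e e0); apply: filterS => y hy /hy.
  by rewrite -opprD normrN.
have [b Kb hb] := usc_attains_max cK K0 (usc_on_continuous cuN).
exists (`|u a| + `|u b|) => x Kx.
rewrite ler_norml; have := ha x Kx; have := hb x Kx.
have := ler_norm (u a); have := ler_norm (- u b); rewrite normrN.
have := normr_ge0 (u a); have := normr_ge0 (u b); lra.
Qed.
End Boundedness.

(** * Barriers, equicontinuity and the maximal solution *)

Section Perron.
Context {R : realType} {n : nat}.
Implicit Types (x y z p : 'rV[R]_n) (u w phi psi chi : 'rV[R]_n -> R).
Variables (Om : set 'rV[R]_n) (nu : 'rV[R]_n -> 'rV[R]_n) (A : set 'rV[R]_n).
Variables (beta : R) (f g : 'rV[R]_n -> R) (M : R).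
Notation GN := (bdry Om `&` A).
Notation GD := (bdry Om `\` A).
Notation S := (Om `|` GN).
Notation cOm := (closure Om).
Hypothesis oOm : open Om.
Hypothesis bOm : bounded_set Om.
Hypothesis bdOm : C1_boundary_with_normal Om nu.
Hypothesis n0 : (0 < n)%N.
Hypothesis oA : open A.
Hypothesis GD0 : GD !=set0.
Hypothesis cvxOm : GN !=set0 -> convex_set Om.
Hypothesis cf : {within S, continuous f}.
Hypothesis M0 : 0 <= M.
Hypothesis fM : forall x, S x -> `|f x| <= M.
Hypothesis cg : {within GD, continuous g}.

Notation sub := (visc_sub Om GN nu beta f).
Notation k := (`|beta| + 1).

Lemma k_gt0 : 0 < k. Proof. by rewrite ltr_wpDl. Qed.

Lemma compact_cOm : compact cOm.
Proof.
by apply: bounded_closed_compact; [exact: bounded_closure|exact: closed_closure].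
Qed.

Lemma GD_closure x : GD x -> cOm x. Proof. by move=> [[]]. Qed.

Lemma compact_GD : compact GD.
Proof.
apply: (subclosed_compact (closed_dirichlet oA) compact_cOm); exact: GD_closure.
Qed.

(** An interior vertex gives the strict Neumann sign through [convex_normal_gt0]; in the equation
    [beta] and [f] are absorbed by |beta| and [M]. *)
Lemma cone_strict : exists C0, 0 <= C0 /\ forall C z x0, C0 <= C -> Om z -> S x0 -> x0 != z ->
  exists psi, [/\ C2 psi, strict_super Om nu A beta f psi x0 &
    \forall y \near x0, cone k C z y - cone k C z x0 <= psi y - psi x0].
Proof.
have [D hD] := bounded_enorm_sub (bounded_closure bOm).
exists ((2 * M + 1) * expR (k * D)); split.
  by rewrite mulr_ge0 ?expR_ge0 //; have := M0; lra.
move=> C z x0 CC Oz Sx0 x0z.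
have xD := hD x0 z (S_closure Sx0) (subset_closure Oz).
have [b [c [b0 gE st np]]] := cone_test M0 CC x0z xD.
set psi := pq _ _ _ _ in gE st np.
have p0 : psi x0 = 0 by rewrite /psi /pq subrr expr0n !mulr0 addr0.
exists psi; split; first exact: C2_pq; last by apply: filterS np => y; rewrite p0 subr0.
split=> [|GNx0].
  have f1 := le_trans (ler_norm _) (fM Sx0).
  have := ler_wpM2r (enorm_ge0 (grad psi x0)) (ler_norm beta); lra.
rewrite gE dotvZl mulr_gt0 ?mulr_gt0 //.
by apply: (convex_normal_gt0 oOm bdOm _ GNx0.1 Oz); apply: cvxOm; exists x0.
Qed.

(* The boundary hypothesis has a margin [d], so that it survives moving the vertex into [Om],
   where the Neumann inequality for the cone is strict. *)
Lemma cone_comparison : exists C0, 0 <= C0 /\ forall C z u a d x,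
  C0 <= C -> cOm z -> sub u -> 0 < d -> u z <= a ->
  (forall y, GD y -> u y <= a \/
     (~ ball z d y /\ u y <= a + C * (1 - expR (- (k * (d / 2)))))) ->
  cOm x -> u x <= a + cone k C z x.
Proof.
have [C0 [C00 hC]] := cone_strict.
exists C0; split => // C z u a d x CC cz su d0 uz hD cx.
apply/ler_addgt0Pr => e e0.
have e2 : 0 < e / 2 by rewrite divr_gt0.
have C_ge0 : 0 <= C by exact: le_trans CC.
(* Half of [e] pays for the growth of [u] at the moved vertex, the other half for the change of the
   cone. *)
have nz1 : \forall z' \near z, cOm z' -> u z' < u z + e / 2 by exact: su.1.
have nz2 : \forall z' \near z, cone k C x z' < cone k C x z + e / 2.
  by apply: near_lt_of_continuous; [exact: cone_continuous|rewrite ltrDl].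
have d2 : 0 < d / 2 by rewrite divr_gt0.
have nz3 := nbhsx_ballx z (d / 2) d2.
have [z' Oz' [h1 [h2 h3]]] := near_ex_closure cz (filterI nz1 (filterI nz2 nz3)).
have cge y : 0 <= cone k C z' y by apply: cone_ge0 => //; exact: ltW k_gt0.
have uz' : u z' <= a + e / 2.
  by apply: ltW (lt_le_trans (h1 (subset_closure Oz')) _); rewrite lerD2r.
have ucmp : u x <= a + e / 2 + cone k C z' x.
  have cphi : continuous (fun y => a + e / 2 + cone k C z' y).
    move=> y; have cc := @cone_continuous _ _ k C z' y.
    exact: (continuousD (@cst_continuous _ R (a + e / 2) y) cc).
  apply: (comparison compact_cOm su cphi _ cx) => x0 cx0.
  have [->|x0z] := eqVneq x0 z'; first by left; rewrite (le_trans uz') // lerDl.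
  case: (closure_S_or_GD A cx0) => [Sx0|GDx0]; [right|left].
    split => //; have [psi [p2 ps np]] := hC C z' x0 CC Oz' Sx0 x0z.
    by exists psi; split => //; apply: filterS np => y; rewrite opprD addrACA subrr add0r.
  have a_le : a <= a + e / 2 by rewrite lerDl ltW.
  case: (hD x0 GDx0) => [ua|[nb ua]].
    by apply: (le_trans ua); apply: (le_trans a_le); rewrite lerDl.
  (* The vertex moved by less than [d / 2], so points outside the ball of radius [d] remain at
     distance at least [d / 2], the radius used in the hypothesis. *)
  have far : d / 2 <= enorm (x0 - z').
    rewrite leNgt; apply/negP => hlt; apply: nb.
    rewrite (splitr d); apply: (ball_triangle h3).
    by apply: enorm_ball; rewrite -opprB enormN.
  apply: (le_trans ua); apply: lerD => //.
  by rewrite /cone ler_wpM2l // lerD2l lerN2 ler_expR lerN2 ler_wpM2l.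
apply: (le_trans ucmp); rewrite [X in _ <= _ + X](splitr e) addrACA lerD2l.
by rewrite coneC (coneC _ _ z) ltW.
Qed.

Definition perron_family : set ('rV[R]_n -> R) :=
  [set u | sub u /\ forall x, GD x -> u x <= g x].
Notation F := perron_family.

Lemma g_bounded : exists G : R, forall x, GD x -> `|g x| <= G.
Proof. exact: compact_continuous_bounded compact_GD GD0 cg. Qed.

Lemma large_height (C0 L d : R) : 0 < d ->
  exists C, C0 <= C /\ L <= C * (1 - expR (- (k * d))).
Proof.
move=> d0; have q0 : 0 < 1 - expR (- (k * d)).
  by rewrite subr_gt0 -expR0 ltr_expR oppr_lt0 mulr_gt0 // k_gt0.
exists (Num.max C0 (L / (1 - expR (- (k * d))))); split; first by rewrite le_max lexx.
by rewrite -ler_pdivrMr // le_max lexx orbT.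
Qed.

(** The opposite of the smooth contact touches the inverted cone from below and is a classical
    subsolution. The vertex is never a tested point, being on [GD], and the nonstrict Neumann sign
    needed here holds for vertices in the closure. *)
Lemma lower_barrier_sub : exists C0, forall C z c, C0 <= C -> GD z ->
  sub (fun x => c - cone k C z x).
Proof.
have [D hD] := bounded_enorm_sub (bounded_closure bOm).
exists ((2 * M + 1) * expR (k * D)) => C z c CC GDz; apply/visc_subP; split.
  apply: usc_on_subr; first exact: cone_continuous.
  by move=> x _ e e0; near=> y; rewrite ltrDl.
move=> x0 Sx0.
have x0z : x0 != z by apply/eqP => xz; apply: (S_notin_GD oOm Sx0); rewrite xz.
have xD := hD x0 z (S_closure Sx0) (GD_closure GDz).
have [b [c' [b0 gE st np]]] := cone_test M0 CC x0z xD.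
set psi := pq _ _ _ _ in gE st np.
have p2 : C2 psi by exact: C2_pq.
have p0 : psi x0 = 0 by rewrite /psi /pq subrr expr0n !mulr0 addr0.
apply: (sub_at_le (w := fun y => - psi y)).
  by apply: filterS np => y h _; rewrite p0; move: h; lra.
apply: (classical_sub_at oOm bdOm n0 (C2N p2) Sx0).
  rewrite (gradN x0 p2) enormN /inf_lap_minus opprK.
  rewrite (_ : (fun y => - - psi y) = psi); last by apply/funext => y; rewrite opprK.
  have f1 := fM Sx0; rewrite ler_norml in f1; move/andP: f1 => [f1 _].
  have f2 := ler_wpM2r (enorm_ge0 (grad psi x0)) (ler_norm (- beta)).
  by rewrite normrN mulNr in f2; lra.
move=> GNx0; rewrite (gradN x0 p2) gE dotvNl oppr_le0 dotvZl mulr_ge0 //.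
  by rewrite mulr_ge0 // ltW.
apply: (convex_normal_closure bdOm _ GNx0.1 (GD_closure GDz)).
by apply: cvxOm; exists x0.
Unshelve. all: by end_near. Qed.

Lemma barriers z (e : R) : GD z -> 0 < e -> exists C, [/\ 0 <= C,
  F (fun x => g z - e - cone k C z x) &
  forall u x, F u -> cOm x -> u x <= g z + e + cone k C z x].
Proof.
move=> GDz e0; have [G hG] := g_bounded.
have [C1 [C10 hC1]] := cone_comparison; have [C2 hC2] := lower_barrier_sub.
move/within_continuousP: cg => /(_ z GDz e e0)/nbhs_ballP[d /= d0 hd].
have d2 : 0 < d / 2 by rewrite divr_gt0.
(* Inside the ball of radius [d] the error [e] covers the variation of [g]; outside, the cone has
   height at least [2 * G], which bounds the oscillation of [g]. *)
have [C [CC CG]] := large_height (Num.max C1 C2) (2 * G) d2.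
move: CC; rewrite ge_max => /andP[CC1 CC2].
have C_ge0 := le_trans C10 CC1.
have cge y : 0 <= cone k C z y by apply: cone_ge0 => //; exact: ltW k_gt0.
have gz := hG z GDz; rewrite ler_norml in gz; move/andP: gz => [gz1 gz2].
exists C; split => //.
  split=> [|y GDy]; first exact: hC2.
  have gy := hG y GDy; rewrite ler_norml in gy; move/andP: gy => [gy1 gy2].
  have [by_|nb] := pselect (ball z d y).
    have := hd y by_ GDy; rewrite ltr_norml => /andP[h1 h2].
    by have := cge y; lra.
  have : C * (1 - expR (- (k * (d / 2)))) <= cone k C z y.
    rewrite /cone ler_wpM2l // lerD2l lerN2 ler_expR lerN2 ler_wpM2l ?(ltW k_gt0) //.
    rewrite leNgt; apply/negP => h; apply: nb; apply: enorm_ball.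
    by rewrite -opprB enormN; apply: (lt_trans h); rewrite ltr_pdivrMr //; lra.
  lra.
move=> u x [su ug] cx; apply: (hC1 C z u _ d x CC1 (GD_closure GDz) su d0 _ _ cx).
  by have := ug z GDz; lra.
move=> y GDy; have uy := ug y GDy.
have gy := hG y GDy; rewrite ler_norml in gy; move/andP: gy => [gy1 gy2].
have [by_|nb] := pselect (ball z d y); [left|right].
  by have := hd y by_ GDy; rewrite ltr_norml => /andP[h1 h2]; lra.
by split => //; lra.
Qed.

(** At each point the maximum coincides with one of the two functions and dominates it nearby. *)
Lemma family_max u w : F u -> F w -> F (fun x => Num.max (u x) (w x)).
Proof.
move=> [/visc_subP[uu su] ug] [/visc_subP[uw sw] wg]; split; last first.
  by move=> x GDx; rewrite ge_max ug ?wg.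
apply/visc_subP; split=> [|x Sx]; first exact: usc_on_max.
have [wu|uw'] := leP (w x) (u x).
  apply: (sub_at_le _ (su x Sx)); near=> y => _.
  by rewrite (max_idPl wu) lerD2r le_max lexx.
apply: (sub_at_le _ (sw x Sx)); near=> y => _.
by rewrite (max_idPr (ltW uw')) lerD2r le_max lexx orbT.
Unshelve. all: by end_near. Qed.

(** Meaningful on the closure of [Om], where [perron_has_sup] applies; elsewhere the members of the
    family are unconstrained. *)
Definition perron x := sup [set u x | u in F].

Lemma perron_has_sup x : cOm x -> has_sup [set u x | u in F].
Proof.
move=> cx; have [z GDz] := GD0; have [C [_ Fw hub]] := barriers GDz ltr01.
split; first by eexists; exists (fun x => g z - 1 - cone k C z x).
by exists (g z + 1 + cone k C z x) => _ [u Fu <-]; exact: hub.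
Qed.

Lemma perron_ge u x : F u -> cOm x -> u x <= perron x.
Proof. by move=> Fu /perron_has_sup[_ ub]; apply: ub_le_sup => //; exists u. Qed.

Lemma perron_le (c : R) x : cOm x -> (forall u, F u -> u x <= c) -> perron x <= c.
Proof.
move=> /perron_has_sup[ne _] h; apply: ge_sup => //.
by move=> _ [u Fu <-]; exact: h.
Qed.

Lemma perron_adherent x (e : R) : cOm x -> 0 < e -> exists2 u, F u & perron x - e < u x.
Proof.
move=> /perron_has_sup hs e0; have [_ [u Fu <-] h] := sup_adherent e0 hs.
by exists u.
Qed.

Lemma perron_barriers z (e : R) : GD z -> 0 < e -> exists C, forall x, cOm x ->
  g z - e - cone k C z x <= perron x <= g z + e + cone k C z x.
Proof.
move=> GDz e0; have [C [_ Fw hub]] := barriers GDz e0.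
exists C => x cx; apply/andP; split; first exact: (perron_ge Fw).
by apply: perron_le => // u Fu; exact: hub.
Qed.

Lemma perron_GD z : GD z -> perron z = g z.
Proof.
move=> GDz; apply/eqP; rewrite eq_le; apply/andP; split; apply/ler_addgt0Pr => e e0;
  have [C /(_ z (GD_closure GDz))] := perron_barriers GDz e0;
  rewrite cone_vertex => /andP[]; lra.
Qed.

(** A member may be very negative at [z], which would force a steep cone to dominate it on [GD]. Its
    maximum with a fixed lower barrier [w] is at least [L] at [z], so height [G - L] suffices for
    every member and every [z]. *)
Lemma perron_cone (d : R) : 0 < d -> exists C, forall z x, cOm z -> cOm x ->
  (forall y, GD y -> ~ ball z d y) -> perron x <= perron z + cone k C z x.
Proof.
move=> d0; have [G hG] := g_bounded; have [C1 [C10 hC1]] := cone_comparison.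
have [z0 GDz0] := GD0; have [C' [C'0 Fw hub]] := barriers GDz0 ltr01.
set w := (fun x => _) in Fw.
(* A cone of height [C'] never exceeds [C'], so [L] bounds [w] from below everywhere; the [1] is the
   tolerance passed to [barriers]. *)
pose L := g z0 - 1 - C'.
have wL x : L <= w x.
  by rewrite /w /L lerD2l lerN2; apply: ler_piMr.
have d2 : 0 < d / 2 by rewrite divr_gt0.
have [C [CC CG]] := large_height C1 (G - L) d2.
exists C => z x cz cx far; apply: perron_le => // u Fu.
have Fv := family_max Fu Fw; set v := (fun x => _) in Fv.
have vz : L <= v z by rewrite le_max wL orbT.
have uv : u x <= v x by rewrite le_max lexx.
apply: (le_trans uv); apply: (@le_trans _ _ (v z + cone k C z x)); last first.
  by rewrite lerD2r; exact: perron_ge.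
apply: (hC1 C z v _ d x CC cz Fv.1 d0 _ _ cx) => // y GDy; right.
split; first exact: far.
apply: le_trans (Fv.2 y GDy) _; apply: le_trans (ler_norm _) _.
apply: le_trans (hG y GDy) _; rewrite -lerBlDl; apply: le_trans CG.
by rewrite lerD2l lerN2.
Qed.

(** Off [GD], cones with vertices at [x] and at the nearby [y] bound the difference from both sides;
    halving [d] keeps [y] far enough from [GD] for the same [C]. On [GD] the two barriers
    squeeze. *)
Lemma perron_continuous : {within cOm, continuous perron}.
Proof.
apply/within_continuousP => x cx e e0.
have [Sx|GDx] := closure_S_or_GD A cx.
  have /nbhs_ballP[d /= d0 hd] := near_notin_dirichlet oOm oA Sx.
  have d2 : 0 < d / 2 by rewrite divr_gt0.
  have [C hC] := perron_cone d2.
  have n1 : \forall y \near x, cone k C x y < e.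
    by apply: near_lt_of_continuous; [exact: cone_continuous|rewrite cone_vertex].
  apply: filterS2 n1 (nbhsx_ballx x (d / 2) d2) => y h1 xy cy.
  have far z : ball x (d / 2) z -> forall p, GD p -> ~ ball z (d / 2) p.
    move=> xz p GDp zp; apply: (hd p _ GDp).
    by rewrite (splitr d); exact: ball_triangle xz zp.
  have i1 := hC x y cx cy (far x (ballxx x d2)).
  have i2 := hC y x cy cx (far y xy).
  by rewrite coneC in i2; rewrite ltr_norml; lra.
have e2 : 0 < e / 2 by rewrite divr_gt0.
have [C hC] := perron_barriers GDx e2.
have n1 : \forall y \near x, cone k C x y < e / 2.
  by apply: near_lt_of_continuous; [exact: cone_continuous|rewrite cone_vertex].
apply: filterS n1 => y h1 cy; have := hC y cy => /andP[i1 i2].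
by rewrite (perron_GD GDx) ltr_norml; lra.
Qed.

Lemma perron_maximal_solution :
  visc_sol_bvp Om GN nu beta f GD g perron /\
  forall u, sub u -> (forall x, GD x -> u x <= g x) -> forall x, cOm x -> u x <= perron x.
Proof.
pose U := perron.
have cU : {within cOm, continuous U} by exact: perron_continuous.
have Uge u x : F u -> cOm x -> u x <= U x.
  by move=> Fu cx; apply: perron_ge.
have subU : sub U.
  apply/visc_subP; split; first exact: usc_on_continuous.
  move=> x Sx; apply: (sup_sub_at oOm bdOm n0 oA compact_cOm cf _ Uge) => //.
    by move=> u [].
  by move=> e e0; apply: perron_adherent => //; exact: S_closure Sx.
have UGD x : GD x -> U x = g x by move=> GDx; apply: perron_GD.
split; last by move=> u su ug x cx; apply: Uge => //; split.
split => //; split => //; split => //; split.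
  apply/lsc_on_oppr; apply: usc_on_continuous; exact: within_continuousN.
move=> phi x c2 Sx [r [r0 m]].
have [//|] := pselect (f x <= - inf_lap_minus phi x - beta * enorm (grad phi x) \/
  GN x /\ 0 <= dotv (grad phi x) (nu x)).
move=> /not_orP[/negP h1 /not_andP h2]; exfalso.
have near_m : \forall y \near x, cOm y -> U x - phi x <= U y - phi y.
  by apply/nbhs_ballP; exists r => // y xy cy; exact: m.
have h1' : - inf_lap_minus phi x - beta * enorm (grad phi x) < f x by rewrite ltNge.
have h2' : GN x -> dotv (grad phi x) (nu x) < 0.
  by move=> GNx; case: h2 => // /negP; rewrite -ltNge.
have [v [sv vg Uv]] := perron_bump oOm bdOm n0 oA cf cU subU c2 Sx near_m h1' h2'.
have Fv : F v.
  by split => // y GDy; rewrite (vg y GDy) UGD.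
by have := Uge v x Fv (S_closure Sx); rewrite leNgt Uv.
Qed.

End Perron.

(** In dimension zero the space is one point, so a boundary point would lie in [Om]. Positive
    dimension is what provides unit vectors. *)
Lemma bdry_dim_gt0 {R : realType} {n : nat} (Om : set 'rV[R]_n) :
  open Om -> bdry Om !=set0 -> (0 < n)%N.
Proof.
move=> oOm [x bx]; case: (posnP n) => // n_eq0; exfalso.
have [y [Oy _]] := bx.1 setT filterT.
apply: (bdry_notin oOm bx); rewrite (_ : x = y) //.
by apply/rowP => i; have := ltn_ord i; rewrite [X in (_ < X)%N]n_eq0.
Qed.

(** * Existence of the extremal solutions *)

Unset Implicit Arguments.
Theorem theorem2p4 (R : realType) (n : nat) (Om : set 'rV[R]_n)
  (nu : 'rV[R]_n -> 'rV[R]_n) (A : set 'rV[R]_n) (beta : R)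
  (f g : 'rV[R]_n -> R) :
  open Om -> bounded_set Om -> connected Om ->
  C1_boundary_with_normal Om nu ->
  open A ->
  bdry Om `\` A !=set0 ->
  (bdry Om `&` A !=set0 -> convex_set Om) ->
  {within Om `|` (bdry Om `&` A), continuous f} ->
  (exists M : R, forall x, (Om `|` (bdry Om `&` A)) x -> `|f x| <= M) ->
  {within bdry Om `\` A, continuous g} ->
  exists ulo uhi : 'rV[R]_n -> R,
    visc_sol_bvp Om (bdry Om `&` A) nu beta f (bdry Om `\` A) g ulo /\
    visc_sol_bvp Om (bdry Om `&` A) nu beta f (bdry Om `\` A) g uhi /\
    (forall u : 'rV[R]_n -> R,
       visc_sub Om (bdry Om `&` A) nu beta f u ->
       (forall x, (bdry Om `\` A) x -> u x <= g x) ->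
       forall x, closure Om x -> u x <= uhi x) /\
    (forall u : 'rV[R]_n -> R,
       visc_super Om (bdry Om `&` A) nu beta f u ->
       (forall x, (bdry Om `\` A) x -> g x <= u x) ->
       forall x, closure Om x -> ulo x <= u x).
Proof.
move=> oOm bOm _ bdOm oA GD0 cvxOm cf [M fM] cg.
have n0 : (0 < n)%N.
  by apply: (bdry_dim_gt0 oOm); have [x [bx _]] := GD0; exists x.
have fM' x : (Om `|` (bdry Om `&` A)) x -> `|f x| <= `|M|.
  by move=> /fM h; exact: le_trans h (ler_norm _).
have fM'N x : (Om `|` (bdry Om `&` A)) x -> `|- f x| <= `|M| by rewrite normrN; exact: fM'.
have M0 : 0 <= `|M| by exact: normr_ge0.
have [hi_sol hi_max] :=
  perron_maximal_solution beta oOm bOm bdOm n0 oA GD0 cvxOm cf M0 fM' cg.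
have [[[cw [subw superw]] wg] w_max] :=
  perron_maximal_solution (- beta) oOm bOm bdOm n0 oA GD0 cvxOm
    (within_continuousN cf) M0 fM'N (within_continuousN cg).
set w := perron _ _ _ _ _ _ in cw subw superw wg w_max.
have fNN (h : 'rV[R]_n -> R) : (fun x => - - h x) = h.
  by apply/funext => x; rewrite opprK.
exists (fun x => - w x), (perron Om nu A beta f g); split; [|split => //; split => //].
  split; last by move=> x /wg ->; rewrite opprK.
  split; first exact: within_continuousN.
  by split; [move/visc_super_oppr: superw; rewrite opprK fNN
            |apply/visc_super_oppr; rewrite fNN].
move=> u /visc_super_oppr su ug x cx.
rewrite lerNl; apply: (w_max _ su _ x cx) => y /ug.
by rewrite lerN2.
Qed.
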